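(* Let $d\in\mathbb{N}$, $a>0$, $b\in\mathbb{R}$. There exist constants $c(a,d)$, $c'(a,d)$ and $C'(a,b,d)$ such that for every $v\in\mathbb{N}$ there is $M$ with $|\Gamma(M)|\le v^{c(a,d)}$ such that, with $\Phi_N:=\{e^{i(\mathbf{k},\mathbf{x})}\}_{\mathbf{k}\in\Gamma(M)}$ and $N=|\Gamma(M)|$, $$\varrho^{ls}_{m,v}(\mathbf{W}^{a,b}_A,\Phi_N,L_2(\mathbb{T}^d))\le C'(a,b,d)\,v^{-a-1/2}(\log v)^{(d-1)(a+b)+1/2}$$ for any $m\ge c'(a,d)\,v(\log(2v))^4$.
   Context: $\mathbb{T}^d=[0,2\pi)^d$ with normalized Lebesgue measure $\mu$, $\|f\|_p=((2\pi)^{-d}\int_{\mathbb{T}^d}|f|^p)^{1/p}$, $\hat f(\mathbf{k})=(2\pi)^{-d}\int_{\mathbb{T}^d}f(\mathbf{x})e^{-i(\mathbf{k},\mathbf{x})}d\mathbf{x}$. $\Gamma(M)=\{\mathbf{k}\in\mathbb{Z}^d:\prod_{j=1}^d\max(|k_j|,1)\le M\}$. For $\mathbf{s}\in\mathbb{N}_0^d$, $\rho(\mathbf{s})=\{\mathbf{k}\in\mathbb{Z}^d:[2^{s_j-1}]\le|k_j|<2^{s_j},\ j=1,\dots,d\}$ ($[\cdot]$ = integer part), $\delta_{\mathbf{s}}(f,\mathbf{x})=\sum_{\mathbf{k}\in\rho(\mathbf{s})}\hat f(\mathbf{k})e^{i(\mathbf{k},\mathbf{x})}$, $f_j=\sum_{\|\mathbf{s}\|_1=j}\delta_{\mathbf{s}}(f)$,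 $\|g\|_A=\sum_{\mathbf{k}}|\hat g(\mathbf{k})|$. $\mathbf{W}^{a,b}_A:=\{f\in L_1(\mathbb{T}^d):\|f_j\|_A\le2^{-aj}\bar j^{(d-1)b},\ \bar j=\max(j,1),\ j\in\mathbb{N}_0\}$. For a dictionary $\Phi_N$, $\mathcal{X}_v(\Phi_N)$ is the collection of spans of $v$-element subsets of $\Phi_N$. For $\xi=(\xi^1,\dots,\xi^m)$ and a finite-dimensional subspace $L$, $LS(\xi,L)(f)$ is an element $u\in L$ minimizing $\frac1m\sum_{j}|f(\xi^j)-u(\xi^j)|^2$, and $\varrho^{ls}_{m,v}(\mathbf{F},\Phi_N,L_2(\mathbb{T}^d)):=\inf_{\xi\in(\mathbb{T}^d)^m}\sup_{f\in\mathbf{F}}\min_{L\in\mathcal{X}_v(\Phi_N)}\|f-LS(\xi,L)(f)\|_2$.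
   Formalization: Proved for v ≥ 2 (for v = 1, |Γ(M)| ≤ 1 forces Γ(M) empty and log v = 0, so the claim fails); functions in W^{a,b}_A are taken as the representative equal to the sum of their Fourier series on the torus, so that point values make sense. *)

(* Defs.v *)
From HB Require Import structures.
From mathcomp Require Import all_boot all_order all_algebra.
From mathcomp Require Import all_classical all_reals all_analysis.
From mathcomp Require Import complex.
Import Order.TTheory GRing.Theory Num.Theory.


Local Open Scope ring_scope.
Local Open Scope classical_set_scope.

Section Defs.
Variable R : realType.
Local Notation C := (R[i]).

Definition cabs (z : C) : R := Num.sqrt (complex.Re z ^+ 2 + complex.Im z ^+ 2).

Definition cexpi (t : R) : C := complex.Complex (cos t) (sin t).

Definition dotk d (k : d.-tuple int) (x : d.-tuple R) : R :=
  \sum_(i < d) (tnth k i)%:~R * tnth x i.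

Definition torus d : set (d.-tuple R) :=
  [set x | forall i : 'I_d, 0 <= tnth x i < 2 * pi].

Definition I02pi : set R := `[0, 2 * pi[.

(* normalized integral over T^d of a [0,+oo]-valued function, written as the
   iterated integral (2pi)^{-1} int_[0,2pi) ... (2pi)^{-1} int_[0,2pi)
   (Tonelli/Fubini: equal to the integral w.r.t. normalized Lebesgue measure mu). *)
Fixpoint tint (d : nat) : (d.-tuple R -> \bar R) -> \bar R :=
  match d return (d.-tuple R -> \bar R) -> \bar R with
  | 0 => fun g => g [tuple]
  | d'.+1 => fun g =>
      (((2 * pi)^-1)%:E *
       \int[lebesgue_measure]_(t in I02pi) tint d' (fun x => g (cons_tuple t x)))%E
  end.

Fixpoint rint (d : nat) : (d.-tuple R -> R) -> R :=
  match d return (d.-tuple R -> R) -> R with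
  | 0 => fun g => g [tuple]
  | d'.+1 => fun g =>
      (2 * pi)^-1 *
       Rintegral lebesgue_measure I02pi (fun t => rint d' (fun x => g (cons_tuple t x)))
  end.

Definition L1 d (f : d.-tuple R -> C) : Prop :=
  [/\ measurable_fun (torus d) (fun x => complex.Re (f x)),
      measurable_fun (torus d) (fun x => complex.Im (f x)) &
      (tint d (fun x => (cabs (f x))%:E) < +oo)%E].

Definition fhat d (f : d.-tuple R -> C) (k : d.-tuple int) : C :=
  complex.Complex
    (rint d (fun x => complex.Re (f x * cexpi (- dotk d k x))))
    (rint d (fun x => complex.Im (f x * cexpi (- dotk d k x)))).

(* k \in rho(s) :  [2^{s_j-1}] <= |k_j| < 2^{s_j}   ( [2^{s-1}] = (2^s)./2 ) *)
Definition inrho d (s : d.-tuple nat) (k : d.-tuple int) : bool :=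
  [forall i : 'I_d, ((2 ^ tnth s i)./2 <= absz (tnth k i) < 2 ^ tnth s i)%N].

(* encoding of integers: t |-> t - 2^j ; for ||s||_1 = j every k in rho(s)
   has |k_i| < 2^j, hence is of the form shift j t for t : d.-tuple 'I_(2^j.+1)
   (and shift j is injective). *)
Definition shift d j (t : d.-tuple 'I_(2 ^ j.+1)) : d.-tuple int :=
  [tuple ((tnth t i : nat)%:Z - (2 ^ j)%:Z) | i < d].

Definition layer_sum (V : nmodType) d (j : nat) (F : d.-tuple int -> V) : V :=
  \sum_(s : d.-tuple 'I_j.+1 | (\sum_(i < d) (tnth s i : nat) == j)%N)
    \sum_(t : d.-tuple 'I_(2 ^ j.+1) | inrho d [tuple (tnth s i : nat) | i < d] (shift d j t))
      F (shift d j t).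

Definition fj d (f : d.-tuple R -> C) (j : nat) (x : d.-tuple R) : C :=
  layer_sum C d j (fun k => fhat d f k * cexpi (dotk d k x)).

Definition Anorm_fj d (f : d.-tuple R -> C) (j : nat) : R :=
  layer_sum R d j (fun k => cabs (fhat d f k)).

(* W^{a,b}_A; f is identified with (the sum of) its Fourier series
   f = sum_j f_j on T^d, which makes point evaluation meaningful. *)
Definition WA d (a b : R) : set (d.-tuple R -> C) :=
  [set f | [/\ L1 d f,
     (forall j : nat, Anorm_fj d f j <=
        2 `^ (- a * j%:R) * (maxn j 1)%:R `^ ((d%:R - 1) * b)) &
     (forall x, torus d x ->
        (fun J : nat => cabs (f x - \sum_(j < J) fj d f j x)) @ \oo --> 0)]].

Definition inGamma d (M : R) (k : d.-tuple int) : Prop :=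
  \prod_(i < d) (maxn (absz (tnth k i)) 1)%:R <= M.

Definition tpoly d (S : seq (d.-tuple int)) (c : d.-tuple int -> C) (x : d.-tuple R) : C :=
  \sum_(k <- S) c k * cexpi (dotk d k x).

Definition emp_err d m (xi : m.-tuple (d.-tuple R)) (f u : d.-tuple R -> C) : R :=
  (m%:R)^-1 * \sum_(j < m) cabs (f (tnth xi j) - u (tnth xi j)) ^+ 2.

Definition is_LS d m (xi : m.-tuple (d.-tuple R)) (S : seq (d.-tuple int))
  (f : d.-tuple R -> C) (c : d.-tuple int -> C) : Prop :=
  forall c', emp_err d m xi f (tpoly d S c) <= emp_err d m xi f (tpoly d S c').

Definition L2norm d (g : d.-tuple R -> C) : \bar R :=
  match tint d (fun x => (cabs (g x) ^+ 2)%:E) with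
  | r%:E => (Num.sqrt r)%:E
  | _ => +oo%E
  end.

Definition vsubsets d (v : nat) (G : seq (d.-tuple int)) : set (seq (d.-tuple int)) :=
  [set S | [/\ uniq S, size S = v & {subset S <= G}]].

(* varrho^{ls}_{m,v}(W, Phi_N, L_2): inf over xi in (T^d)^m, sup over f in W,
   min over L in X_v(Phi_N) of ||f - LS(xi,L)(f)||_2; if LS(xi,L)(f) is not
   unique we take the worst least squares element. *)
Definition rho_ls d (m v : nat) (W : set (d.-tuple R -> C)) (G : seq (d.-tuple int)) : \bar R :=
  ereal_inf [set
    ereal_sup [set
      ereal_inf [set
        ereal_sup [set L2norm d (fun x => f x - tpoly d S c x) | c in is_LS d m xi S f]
      | S in vsubsets d v G]
    | f in W]
  | xi in [set xi : m.-tuple (d.-tuple R) | forall j : 'I_m, torus d (tnth xi j)]].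

End Defs.

(* Main.v *)
(** Least squares on an at most [v]-dimensional span loses only the constant of the
    one-sided inequality [||u||_2^2 <= La * ||u||_xi^2] for [v]-sparse [u], and
    the factor [(log v)^(1/2)] in the claim allows [La] of order [log v].

    For the inequality, the sample points are taken on a finite grid that
    integrates all the relevant polynomials exactly.  If [||u||_2 = 1], then for
    some dyadic level [2^i <= 2 v] the set [|u|^2 >= 2^i / 2] has measure at least
    [p = c 2^-i / log v].  By Maurey's empirical method, [u] is approximated, off a
    set of measure much smaller than [p] both for the grid measure and for the
    sampling measure, by an average of about [v 2^-i log v] exponentials; there are
    few such averages, so a Chernoff bound and a union bound give sample points
    that see each of their large level sets.  All probabilistic choices are made
    one at a time by averaging, so that no product measure is needed.

    For [f] in the class, the layers [f_j] with [j < n], where [2^n n^(d-1)] is about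
    [v], are kept entirely; the layers [n <= j < J] are replaced by at most [v/2]
    terms using Maurey's method in [L_2] of the sum of the two measures; the layers
    beyond [J], which is of order [log v], are uniformly negligible. *)

Require Import Defs.
From HB Require Import structures.
From mathcomp Require Import all_boot all_order all_algebra.
From mathcomp Require Import all_classical all_reals all_analysis.
From mathcomp Require Import complex.
From mathcomp Require Import ring lra zify.
Import Order.TTheory GRing.Theory Num.Theory.
Import numFieldNormedType.Exports.
Local Open Scope ring_scope.
Local Open Scope classical_set_scope.

(** * Choices by averaging *)

(** A union bound cannot run over the sparse sums [u] themselves, and [|u|^2] can be of order [v] on
    a small set, so the sample points have to see small sets. Replacing [u] by an average of [s]
    atoms leaves [(4 * #|I|) ^ s] events. At height [2^i] the guaranteed measure [p] is only of
    order [2^-i / log v], but there an error relative to the height suffices, so [s] may shrink like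
    [2^-i] too: [s * log #|I| / p] is of order [v (log v)^3] at every level. The atoms may be chosen
    after the sample points, since these serve all tuples of atoms; hence one tuple can be good for
    both measures.

    In the error bound, the layers from [n] on have total [A]-norm of order
    [v^-a (log v)^((d-1)(a+b))], and Maurey's method with about [v/2] terms gains the further
    [v^(-1/2)]. The function [f] is not a polynomial, so neither grid quadrature nor the sampling
    inequality applies to it; its Fourier sum up to [J] stands in for it, with a remainder bounded
    pointwise on the torus. *)

Section Averaging.
Variable R : realType.

Lemma exists_le_wavg (A : finType) (w F : A -> R) (B : R) :
  (forall a, 0 <= w a) -> \sum_a w a = 1 -> \sum_a w a * F a <= B ->
  exists a, F a <= B.
Proof.
move=> w0 w1 FB; apply: contrapT => nF.
have ltF a : B < F a.
  by rewrite ltNge; apply/negP => h; apply: nF; exists a.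
have ge0 a : 0 <= w a * (F a - B) by rewrite mulr_ge0// subr_ge0 ltW.
have e0 : \sum_a w a * (F a - B) == 0.
  rewrite eq_le sumr_ge0// andbT.
  by under eq_bigr do rewrite mulrBr; rewrite sumrB -mulr_suml w1 mul1r subr_le0.
rewrite psumr_eq0// in e0.
have wz a : w a = 0.
  move/allP: e0 => /(_ a (mem_index_enum _))/=.
  by rewrite mulf_eq0 => /orP[/eqP//|]; rewrite subr_eq0 gt_eqF.
move: w1; rewrite big1// => /eqP; rewrite eq_sym oner_eq0//.
Qed.

Lemma exists_le_avg (X : finType) (F : X -> R) (B : R) :
  (0 < #|X|)%N -> \sum_x F x <= #|X|%:R * B -> exists x, F x <= B.
Proof.
move=> X0 FB; have X0' : 0 < #|X|%:R :> R by rewrite ltr0n.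
apply: (@exists_le_wavg _ (fun=> #|X|%:R^-1)).
- by move=> _; rewrite invr_ge0 ler0n.
- by rewrite sumr_const -[RHS](@mulVf _ #|X|%:R) ?gt_eqF// mulr_natr.
- by rewrite -mulr_sumr mulrC ler_pdivrMr// mulrC.
Qed.

(** From [1 - x <= exp (-x)] one gets [exp x <= 1 / (1 - x)], and [(1 - x) (1 + x + 2 x^2) = 1 + x^2
    (1 - 2 x)] is at least [1] for [x <= 1/2]. *)
Lemma expR_le_quad (x : R) : x <= 2^-1 -> expR x <= 1 + x + 2 * x ^+ 2.
Proof.
move=> x2.
have h1 : 1 - x <= (expR x)^-1 by rewrite -expRN expR_ge1Dx.
have h2 : 0 < 1 - x by lra.
have : expR x <= (1 - x)^-1.
  by rewrite -[leLHS]invrK lef_pV2// posrE ?invr_gt0 ?expR_gt0.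
move=> /le_trans; apply.
rewrite -div1r ler_pdivrMr//.
have := sqr_ge0 x; nra.
Qed.

Section Maurey.
Variables (A Y : finType) (w : A -> R) (psi : A -> Y -> R).
Hypothesis w_ge0 : forall a, 0 <= w a.
Hypothesis w_sum1 : \sum_a w a = 1.
Hypothesis psi_le1 : forall a y, `|psi a y| <= 1.

Let mean y := \sum_a w a * psi a y.

Let dev_mean0 y : \sum_a w a * (mean y - psi a y) = 0.
Proof.
by under eq_bigr do rewrite mulrBr; rewrite sumrB -mulr_suml w_sum1 mul1r subrr.
Qed.

Let mean_le1 y : `|mean y| <= 1.
Proof.
apply: le_trans (ler_norm_sum _ _ _) _; rewrite -w_sum1; apply: ler_sum => a _.
by rewrite normrM ger0_norm// ler_piMr.
Qed.

Let dev_le2 a y : `|mean y - psi a y| <= 2.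
Proof. by apply: le_trans (ler_normB _ _) _; exact: (lerD (mean_le1 y)). Qed.

Let dev_sq a y : (mean y - psi a y) ^+ 2 <= 4.
Proof.
rewrite -real_normK ?num_real//.
by have := dev_le2 a y; have := normr_ge0 (mean y - psi a y); nra.
Qed.

(** Atoms are drawn one at a time. For a random atom the linear term of the exponential has mean
    zero, so its factor has mean at most [1 + 8 lam^2] at each [y], and some atom does no worse
    after summation against [nu]. The induction absorbs that factor into [nu], which is why the
    weights are general. *)
Lemma maurey_exp (lam : R) (n : nat) (nu : Y -> R) :
  0 <= lam <= 4^-1 -> (forall y, 0 <= nu y) ->
  exists s : n.-tuple A,
    \sum_y nu y * expR (lam * \sum_(a <- s) (mean y - psi a y)) <=
    expR (8 * lam ^+ 2 * n%:R) * \sum_y nu y.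
Proof.
move=> lam01; elim: n nu => [|n IH] nu nu0.
  exists [tuple]; rewrite mulr0 expR0 mul1r.
  by under eq_bigr do rewrite big_nil mulr0 expR0 mulr1.
have [a aP] : exists a, \sum_y nu y * expR (lam * (mean y - psi a y)) <=
    expR (8 * lam ^+ 2) * \sum_y nu y.
  apply: (exists_le_wavg _ w) => //.
  under eq_bigr do rewrite mulr_sumr.
  rewrite exchange_big/= mulr_sumr; apply: ler_sum => y _.
  under eq_bigr do rewrite mulrCA.
  rewrite -mulr_sumr mulrC ler_wpM2r//.
  apply: (@le_trans _ _ (1 + 8 * lam ^+ 2)); last exact: expR_ge1Dx.
  pose q a := 1 + lam * (mean y - psi a y) + 8 * lam ^+ 2.
  apply: (@le_trans _ _ (\sum_a w a * q a)).
    apply: ler_sum => a _; apply: ler_wpM2l => //.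
    apply: le_trans (expR_le_quad _ _) _.
      apply: le_trans (ler_norm _) _; rewrite normrM ger0_norm; last lra.
      have := dev_le2 a y; have := normr_ge0 (mean y - psi a y); nra.
    rewrite /q lerD2l exprMn.
    by have := dev_sq a y; have := sqr_ge0 lam; nra.
  rewrite (eq_bigr (fun a => w a * (1 + 8 * lam ^+ 2) +
      lam * (w a * (mean y - psi a y)))); last by move=> a _; rewrite /q; ring.
  by rewrite big_split/= -mulr_sumr dev_mean0 mulr0 addr0 -mulr_suml w_sum1 mul1r.
have [s sP] := IH (fun y => nu y * expR (lam * (mean y - psi a y)))
  (fun y => mulr_ge0 (nu0 y) (expR_ge0 _)).
exists [tuple of a :: s].
rewrite (eq_bigr (fun y => nu y * expR (lam * (mean y - psi a y)) *
    expR (lam * \sum_(a <- s) (mean y - psi a y)))); last first.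
  by move=> y _; rewrite /= big_cons (mulrDr lam) expRD mulrA.
apply: le_trans sP _.
rewrite -(natr1 n) mulrDr mulr1 expRD -[leRHS]mulrA ler_wpM2l ?expR_ge0//.
Qed.

(** Given the partial sum [D], the cross term with a random next atom has mean zero, so some atom
    raises the weighted square by at most [4] times the mass of [nu]. *)
Lemma maurey_L2 (n : nat) (nu : Y -> R) : (forall y, 0 <= nu y) ->
  exists s : n.-tuple A,
    \sum_y nu y * (\sum_(a <- s) (mean y - psi a y)) ^+ 2 <=
    4 * n%:R * \sum_y nu y.
Proof.
move=> nu0; elim: n => [|n [s IH]].
  exists [tuple]; rewrite mulr0 mul0r big1// => y _.
  by rewrite big_nil expr0n/= mulr0.
pose D y := \sum_(a <- s) (mean y - psi a y).
have [a aP] : exists a, \sum_y nu y * (mean y - psi a y + D y) ^+ 2 <=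
    4 * n.+1%:R * \sum_y nu y.
  apply: (exists_le_wavg _ w) => //.
  apply: (@le_trans _ _ (\sum_y nu y * (4 + D y ^+ 2))); last first.
    under eq_bigr do rewrite mulrDr.
    rewrite big_split/= -mulr_suml -(natr1 n).
    by rewrite /D; lra.
  under eq_bigr do rewrite mulr_sumr.
  rewrite exchange_big/=; apply: ler_sum => y _.
  under eq_bigr do rewrite mulrCA.
  rewrite -mulr_sumr ler_wpM2l//.
  apply: (@le_trans _ _ (\sum_a (w a * (4 + D y ^+ 2) +
      2 * D y * (w a * (mean y - psi a y))))).
    apply: ler_sum => a _.
    have : w a * (mean y - psi a y) ^+ 2 <= w a * 4 by rewrite ler_wpM2l.
    by rewrite sqrrD; nra.
  by rewrite big_split/= -mulr_suml w_sum1 mul1r -mulr_sumr dev_mean0 mulr0 addr0.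
exists [tuple of a :: s].
by under eq_bigr do rewrite big_cons.
Qed.

End Maurey.

(* Averaging over one sample point multiplies the weight of the event [g] by
   [1 - P(E g) / 2 <= exp (- p g / 2)]. *)
Lemma chernoff_weights (X I : finType) (E : I -> pred X) (p : I -> R) (m : nat)
    (W : I -> R) :
  (0 < #|X|)%N -> (forall g, p g * #|X|%:R <= #|E g|%:R) ->
  (forall g, 0 <= W g) ->
  exists xi : m.-tuple X,
    \sum_g W g * 2^-1 ^+ count (E g) xi <= \sum_g W g * expR (- (p g * m%:R / 2)).
Proof.
move=> X0 pE; elim: m W => [|m IH] W W0.
  exists [tuple]; under eq_bigr do rewrite expr0.
  by under [leRHS]eq_bigr do rewrite mulr0 mul0r oppr0 expR0.
have [x xP] : exists x, \sum_g W g * 2^-1 ^+ E g x * expR (- (p g * m%:R / 2)) <=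
    \sum_g W g * expR (- (p g * m.+1%:R / 2)).
  apply: exists_le_avg => //.
  rewrite exchange_big mulr_sumr/=; apply: ler_sum => g _.
  under eq_bigr do rewrite -mulrA.
  rewrite -mulr_sumr mulrCA ler_wpM2l// -mulr_suml.
  have -> : \sum_x 2^-1 ^+ E g x = #|X|%:R - #|E g|%:R / 2 :> R.
    rewrite (eq_bigr (fun x => 1 - (if x \in E g then 2^-1 else 0))).
      rewrite sumrB -big_mkcond/= !sumr_const; congr (_ - _).
      by rewrite -[LHS]mulr_natl.
    move=> x _; rewrite unfold_in; case: (E g x); rewrite ?expr0 ?expr1 ?subr0//.
    by lra.
  rewrite -(natr1 m) mulrDr mulr1 mulrDl opprD expRD mulrCA mulrC.
  rewrite ler_wpM2l ?expR_ge0//.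
  have := expR_ge1Dx (- (p g / 2)); have := pE g.
  have : 0 <= #|X|%:R :> R by [].
  nra.
have [|xi xiP] := IH (fun g => W g * 2^-1 ^+ E g x).
  by move=> g; rewrite mulr_ge0// exprn_ge0// invr_ge0.
exists [tuple of x :: xi] => /=.
under eq_bigr do rewrite exprD mulrA.
exact: le_trans xP.
Qed.

(** With weights [exp (p m / 4)] the total is below [1], hence so is each nonnegative term
    [exp (p m / 4) / 2^count]; then [2 <= e] compares the exponents. *)
Lemma chernoff_select (X I : finType) (E : I -> pred X) (p : I -> R) (m : nat) :
  (0 < #|X|)%N -> (forall g, p g * #|X|%:R <= #|E g|%:R) ->
  \sum_g expR (- (p g * m%:R / 4)) < 1 ->
  exists xi : m.-tuple X, forall g, p g * m%:R / 4 <= (count (E g) xi)%:R.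
Proof.
move=> X0 pE lt1.
have [|xi xiP] := @chernoff_weights _ _ E p m (fun g => expR (p g * m%:R / 4)) X0 pE.
  by move=> g; exact: expR_ge0.
exists xi => g.
have {xiP}sum_lt1 : \sum_g expR (p g * m%:R / 4) * 2^-1 ^+ count (E g) xi < 1.
  apply: le_lt_trans xiP _; apply: le_lt_trans lt1.
  rewrite le_eqVlt; apply/orP; left; apply/eqP; apply: eq_bigr => i _.
  by rewrite -expRD; congr expR; lra.
have : expR (p g * m%:R / 4) * 2^-1 ^+ count (E g) xi < 1.
  apply: le_lt_trans sum_lt1; rewrite (bigD1 g)//= lerDl sumr_ge0//.
rewrite exprVn ltr_pdivrMr ?exprn_gt0// mul1r => /ltW h.
rewrite -ler_expR; apply: le_trans h _.
rewrite -[X in expR X]mulr1 expRM_natl.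
apply: lerXn2r; rewrite ?nnegrE ?expR_ge0//.
by have := expR_ge1Dx (1 : R); lra.
Qed.

End Averaging.

(** * Complex moduli and finite sums *)

Section ComplexModulus.
Variable R : realType.
Local Notation C := R[i].
Implicit Types z w : C.

Definition sqn z : R := complex.Re z ^+ 2 + complex.Im z ^+ 2.

Lemma cabs_sq z : cabs R z ^+ 2 = sqn z.
Proof. by rewrite /cabs sqr_sqrtr// addr_ge0// sqr_ge0. Qed.

Lemma cabs_ge0 z : 0 <= cabs R z.
Proof. exact: sqrtr_ge0. Qed.

Lemma cabs0 : cabs R 0 = 0.
Proof. by rewrite /cabs/= expr0n/= addr0 sqrtr0. Qed.

Lemma sqn_ge0 z : 0 <= sqn z.
Proof. by rewrite addr_ge0// sqr_ge0. Qed.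

Lemma sqn0 : sqn 0 = 0.
Proof. by rewrite /sqn/= expr0n/= addr0. Qed.

Lemma sqnM z w : sqn (z * w) = sqn z * sqn w.
Proof. by case: z => a b; case: w => c e; rewrite /sqn/=; ring. Qed.

Lemma sqnN z : sqn (- z) = sqn z.
Proof. by case: z => a b; rewrite /sqn/=; ring. Qed.

Lemma sqnD_le z w : sqn (z + w) <= 2 * sqn z + 2 * sqn w.
Proof.
case: z => a b; case: w => c e; rewrite /sqn/=.
by have := sqr_ge0 (a - c); have := sqr_ge0 (b - e); nra.
Qed.

Lemma sqnB_le z w : sqn (z - w) <= 2 * sqn z + 2 * sqn w.
Proof. by rewrite -(sqnN w); exact: sqnD_le. Qed.

Lemma sqn_real (r : R) : sqn r%:C%C = r ^+ 2.
Proof. by rewrite /sqn/= expr0n/= addr0. Qed.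

Lemma cabs_normc z : cabs R z = ComplexField.Normc.normc z.
Proof. by case: z. Qed.

Lemma cabsM z w : cabs R (z * w) = cabs R z * cabs R w.
Proof. by rewrite !cabs_normc ComplexField.Normc.normcM. Qed.

Lemma cabsD_le z w : cabs R (z + w) <= cabs R z + cabs R w.
Proof. by rewrite !cabs_normc le_normcD. Qed.

Lemma cabs_sum_le (T : Type) (s : seq T) (P : pred T) (F : T -> C) :
  cabs R (\sum_(t <- s | P t) F t) <= \sum_(t <- s | P t) cabs R (F t).
Proof.
elim/big_rec2: _ => [|t x y _ h]; first by rewrite cabs0.
by apply: le_trans (cabsD_le _ _) _; rewrite lerD2l.
Qed.

Lemma ReD z w : complex.Re (z + w) = complex.Re z + complex.Re w.
Proof. by case: z; case: w. Qed.

Lemma ImD z w : complex.Im (z + w) = complex.Im z + complex.Im w.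
Proof. by case: z; case: w. Qed.

Lemma Re_sum (T : Type) (s : seq T) (P : pred T) (F : T -> C) :
  complex.Re (\sum_(t <- s | P t) F t) = \sum_(t <- s | P t) complex.Re (F t).
Proof. by elim/big_rec2: _ => //= t x y _ <-; rewrite ReD. Qed.

Lemma Im_sum (T : Type) (s : seq T) (P : pred T) (F : T -> C) :
  complex.Im (\sum_(t <- s | P t) F t) = \sum_(t <- s | P t) complex.Im (F t).
Proof. by elim/big_rec2: _ => //= t x y _ <-; rewrite ImD. Qed.

Lemma Re_le_cabs z : `|complex.Re z| <= cabs R z.
Proof.
rewrite /cabs -sqrtr_sqr ler_wsqrtr// lerDl sqr_ge0//.
Qed.

Lemma Im_le_cabs z : `|complex.Im z| <= cabs R z.
Proof.
rewrite /cabs -sqrtr_sqr ler_wsqrtr// lerDr sqr_ge0//.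
Qed.

(* [true] selects the real part. *)
Definition part (b : bool) z : R := if b then complex.Re z else complex.Im z.

Lemma partD b z w : part b (z + w) = part b z + part b w.
Proof. by case: b; rewrite /= ?ReD ?ImD. Qed.

Lemma partN b z : part b (- z) = - part b z.
Proof. by case: b; case: z. Qed.

Lemma part_sum b (T : Type) (s : seq T) (P : pred T) (F : T -> C) :
  part b (\sum_(t <- s | P t) F t) = \sum_(t <- s | P t) part b (F t).
Proof. by case: b; rewrite /= ?Re_sum ?Im_sum. Qed.

Lemma part_realM b (r : R) z : part b (r%:C%C * z) = r * part b z.
Proof. by case: b; case: z => x y /=; ring. Qed.

Lemma part_le1 b z : sqn z <= 1 -> `|part b z| <= 1.
Proof.
move=> z1; have h : cabs R z <= 1.
  by rewrite -(@ler_pXn2r _ 2)// ?nnegrE ?cabs_ge0// cabs_sq expr1n.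
by case: b; [apply: le_trans h; exact: Re_le_cabs|apply: le_trans h; exact: Im_le_cabs].
Qed.

Lemma sqn_part z : sqn z = \sum_(b : bool) part b z ^+ 2.
Proof. by rewrite big_bool. Qed.

End ComplexModulus.

Section FiniteSums.
Variable R : realType.

(** Cauchy-Schwarz, as nonnegativity of a variance. *)
Lemma sqr_sum_le (I : finType) (S : pred I) (a : I -> R) :
  (\sum_(i | S i) a i) ^+ 2 <= #|S|%:R * \sum_(i | S i) a i ^+ 2.
Proof.
set n : R := #|S|%:R; set s := \sum_(i | S i) a i.
have [S0|S0] := eqVneq #|S| 0%N.
  have -> : s = 0 by apply: big1 => i Si; move/card0_eq: S0 => /(_ i); rewrite unfold_in Si.
  by rewrite expr0n/= mulr_ge0 ?ler0n// sumr_ge0// => i _; rewrite sqr_ge0.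
have n0 : 0 < n by rewrite ltr0n lt0n.
have : 0 <= \sum_(i | S i) (n * a i - s) ^+ 2 by apply: sumr_ge0 => i _; rewrite sqr_ge0.
rewrite (eq_bigr (fun i => n ^+ 2 * a i ^+ 2 + (s ^+ 2 - (2 * n * s) * a i)));
  last by move=> i _; ring.
rewrite big_split/= sumrB -!mulr_sumr -/s sumr_const -mulr_natr -/n.
set q := \sum_(i | S i) _ => h.
rewrite -(ler_pM2l n0); nra.
Qed.

(** Turns a sum over sample points, counted with repetition, into a weighted sum over the whole
    grid, so that the sampling measure can be added to the grid measure. *)
Lemma sum_count_mem (X : finType) (s : seq X) (F : X -> R) :
  \sum_x (count_mem x s)%:R * F x = \sum_(x <- s) F x.
Proof.
elim: s => [|y s IH]; first by rewrite big_nil big1// => x _; rewrite mul0r.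
rewrite big_cons -IH (eq_bigr (fun x => (y == x)%:R * F x + (count_mem x s)%:R * F x)).
  rewrite big_split/=; congr (_ + _).
  rewrite (bigD1 y)//= eqxx mul1r big1 ?addr0// => x /negbTE xy.
  by rewrite eq_sym xy mul0r.
by move=> x _; rewrite -mulrDl -natrD.
Qed.

End FiniteSums.

Section SignedAtoms.
Variables (R : realType) (J : finType) (Y : Type).
Variables (t : J -> R) (A0 : R) (chi : J -> Y -> R).
Hypotheses (J0 : (0 < #|J|)%N) (A00 : 0 < A0) (tA : \sum_j `|t j| <= A0).

(* The mass left over after normalising by [A0] is spread evenly over all signed
   atoms, where it cancels. *)
Lemma signed_atoms : exists w : J * bool -> R,
  [/\ forall a, 0 <= w a, \sum_a w a = 1 &
   forall y, \sum_a w a * ((-1) ^+ a.2 * chi a.1 y) = A0^-1 * \sum_j t j * chi j y].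
Proof.
pose r := (1 - A0^-1 * \sum_j `|t j|) / (2 * #|J|%:R).
have r0 : 0 <= r.
  rewrite divr_ge0 ?mulr_ge0 ?ler0n// subr_ge0 mulrC ler_pdivrMr// mul1r//.
pose w (a : J * bool) := A0^-1 * Num.max ((-1) ^+ a.2 * t a.1) 0 + r.
have pairE (F : J * bool -> R) : \sum_a F a = \sum_j (F (j, true) + F (j, false)).
  rewrite (eq_bigr (fun a => F (a.1, a.2))); last by case.
  by rewrite -(pair_bigA _ (fun j b => F (j, b)))/=; under eq_bigr do rewrite big_bool.
have maxD x : Num.max ((-1) ^+ true * x) 0 + Num.max ((-1) ^+ false * x) 0 = `|x| :> R.
  rewrite expr1 expr0 mulN1r mul1r; have /orP[x0|x0] := le_total 0 x.
    by rewrite max_r ?oppr_le0// max_l// add0r ger0_norm.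
  by rewrite max_l ?oppr_ge0// max_r// addr0 ler0_norm.
have maxB x : Num.max ((-1) ^+ false * x) 0 - Num.max ((-1) ^+ true * x) 0 = x :> R.
  rewrite expr1 expr0 mulN1r mul1r; have /orP[x0|x0] := le_total 0 x.
    by rewrite max_l// max_r ?oppr_le0// subr0.
  by rewrite max_r// max_l ?oppr_ge0// sub0r opprK.
exists w; split.
- by move=> a; rewrite /w addr_ge0// mulr_ge0 ?invr_ge0 ?(ltW A00)// le_max lexx orbT.
- rewrite pairE /w/=.
  rewrite (eq_bigr (fun j => A0^-1 * `|t j| + 2 * r)); last first.
    by move=> j _; rewrite -maxD; ring.
  rewrite big_split/= -mulr_sumr sumr_const -mulr_natr /r.
  have nJ0 : #|J|%:R != 0 :> R by rewrite pnatr_eq0 -lt0n.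
  have nA0 : A0 != 0 by rewrite gt_eqF.
  by field; rewrite ?nJ0 ?nA0.
- move=> y; rewrite pairE mulr_sumr; apply: eq_bigr => j _.
  rewrite /w/= -{3}(maxB (t j)) expr1 expr0; ring.
Qed.

End SignedAtoms.

(** * Maurey's method for complex atoms *)

Section ComplexMaurey.
Variables (R : realType) (I X : finType).
Local Notation C := R[i].
Variable phi : I -> X -> C.
Hypothesis phi_le1 : forall i x, sqn R (phi i x) <= 1.
Hypothesis I0 : (0 < #|I|)%N.

(** Complex coefficients become real weights on the rotations of each [phi i] by [1], [-1], [i],
    [-i]. The price is the norm [|Re c| + |Im c|] and an alphabet of [4 * #|I|] atoms. *)
Definition rot (r : bool) : C := if r then 1 else 'i%C.

Definition atom (a : I * bool * bool) (x : X) : C :=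
  ((-1) ^+ a.2)%:C%C * (rot a.1.2 * phi a.1.1 x).

Lemma sqn_atom a x : sqn R (atom a x) <= 1.
Proof.
rewrite /atom !sqnM sqn_real sqrr_sign mul1r.
have -> : sqn R (rot a.1.2) = 1.
  by rewrite /rot; case: ifP => _; rewrite /sqn/= !expr2; ring.
by rewrite mul1r.
Qed.

Variables (c : I -> C) (A0 : R).
Hypothesis A00 : 0 < A0.
Hypothesis cA : \sum_i (`|complex.Re (c i)| + `|complex.Im (c i)|) <= A0.

Let u x := \sum_i c i * phi i x.
Let chi (j : I * bool) (y : X * bool) : R := part R y.2 (rot j.2 * phi j.1 y.1).

(** For [s] of length [n] this is [n] times the error of the average of [s] as an approximation of
    [u / A0]; left undivided, it is a plain sum of [n] centred terms. *)
Definition deviation n (s : seq (I * bool * bool)) x : C :=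
  (n%:R / A0)%:C%C * u x - \sum_(a <- s) atom a x.

Let sum_chi y : \sum_j part R j.2 (c j.1) * chi j y = part R y.2 (u y.1).
Proof.
rewrite -(pair_bigA _ (fun i r => part R r (c i) * chi (i, r) y))/= part_sum.
apply: eq_bigr => i _; rewrite big_bool /chi/=.
by case: (c i) => a b; case: (phi i y.1) => e f; case: y.2; rewrite /=; ring.
Qed.

Let part_atom b a x : part R b (atom a x) = (-1) ^+ a.2 * chi a.1 (x, b).
Proof. by rewrite /atom part_realM. Qed.

Let weights : exists w : I * bool * bool -> R,
  [/\ forall a, 0 <= w a, \sum_a w a = 1 &
   forall x b, \sum_a w a * part R b (atom a x) = A0^-1 * part R b (u x)].
Proof.
have J0 : (0 < #|{: I * bool}|)%N by rewrite card_prod card_bool muln_gt0 I0.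
have tA : \sum_(j : I * bool) `|part R j.2 (c j.1)| <= A0.
  apply: le_trans cA; rewrite -(pair_bigA _ (fun i r => `|part R r (c i)|))/=.
  by under eq_bigr do rewrite big_bool/=.
have [w [w0 w1 wE]] := signed_atoms R _ _ _ _ chi J0 A00 tA.
exists w; split=> // x b.
under eq_bigr do rewrite part_atom.
by rewrite wE sum_chi.
Qed.

Let part_deviation n (s : n.-tuple (I * bool * bool)) b x :
  part R b (deviation n s x) =
  \sum_(a <- s) (A0^-1 * part R b (u x) - part R b (atom a x)).
Proof.
rewrite sumrB -part_sum big_const_seq count_predT size_tuple iter_addr_0.
by rewrite /deviation partD partN part_realM -[(_ * _) *+ n]mulr_natl mulrA.
Qed.

(** One tuple handles the real and imaginary parts with both signs, hence the factor [4]. *)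
Lemma maurey_exp_complex (lam : R) (n : nat) (nu : X -> R) :
  0 <= lam <= 4^-1 -> (forall x, 0 <= nu x) ->
  exists s : n.-tuple (I * bool * bool),
    \sum_x nu x * \sum_b \sum_(sg : bool)
       expR (lam * ((-1) ^+ sg * part R b (deviation n s x))) <=
    4 * expR (8 * lam ^+ 2 * n%:R) * \sum_x nu x.
Proof.
move=> lam01 nu0; have [w [w0 w1 wE]] := weights.
pose psi a (y : X * (bool * bool)) : R := (-1) ^+ y.2.2 * part R y.2.1 (atom a y.1).
have psi1 a y : `|psi a y| <= 1.
  by rewrite /psi normrM normrX normrN1 expr1n mul1r part_le1// sqn_atom.
have [s sP] := maurey_exp R _ _ w psi w0 w1 psi1 lam n (fun y => nu y.1) lam01
  (fun y => nu0 y.1).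
have tripleE (F : X -> bool -> bool -> R) :
    \sum_(y : X * (bool * bool)) F y.1 y.2.1 y.2.2 = \sum_x \sum_b \sum_sg F x b sg.
  rewrite -(pair_bigA _ (fun x (q : bool * bool) => F x q.1 q.2))/=.
  by apply: eq_bigr => x _; rewrite -(pair_bigA _ (fun b sg => F x b sg)).
exists s.
apply: (le_trans (le_trans _ sP)).
  rewrite (tripleE (fun x b sg => nu x * expR (lam * \sum_(a <- s)
     (\sum_a w a * psi a (x, (b, sg)) - psi a (x, (b, sg))))))/=.
  rewrite le_eqVlt; apply/orP; left; apply/eqP/eq_bigr => x _.
  rewrite mulr_sumr; apply: eq_bigr => b _; rewrite mulr_sumr; apply: eq_bigr => sg _.
  congr (_ * expR (_ * _)); rewrite part_deviation mulr_sumr; apply: eq_bigr => a _.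
  rewrite mulrBr; congr (_ - _); rewrite -wE mulr_sumr; apply: eq_bigr => a' _.
  by rewrite mulrCA.
rewrite (tripleE (fun x b sg => nu x)).
rewrite mulrC [leRHS]mulrAC ler_wpM2r ?expR_ge0//.
rewrite mulr_sumr; apply: ler_sum => x _.
by rewrite !big_bool/=; lra.
Qed.

(** Exponential Markov inequality with [lam = tau / 32], at most [1/4] because [tau <= 8]. A squared
    modulus above [n^2 tau^2] forces a part of absolute value at least [n tau / 2], so one of the
    four exponentials is at least [exp (n tau^2 / 64)]; half of this exponent is spent on
    [8 lam^2 n]. *)
Lemma maurey_tail (tau : R) (n : nat) (nu : X -> R) :
  0 <= tau <= 8 -> (forall x, 0 <= nu x) ->
  exists s : n.-tuple (I * bool * bool),
    \sum_x nu x * (n%:R ^+ 2 * tau ^+ 2 < sqn R (deviation n s x))%R%:R <=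
    4 * expR (- (n%:R * tau ^+ 2 / 128)) * \sum_x nu x.
Proof.
move=> tau0 nu0.
have [|s sP] := @maurey_exp_complex (tau / 32) n nu _ nu0; first by apply/andP; split; lra.
exists s; set e := expR (tau / 32 * (n%:R * tau / 2)).
have e0 : 0 < e by rewrite expR_gt0.
rewrite -(ler_pM2l e0); apply: (le_trans (le_trans _ sP)); last first.
  rewrite [leRHS]mulrA ler_wpM2r ?sumr_ge0// [leRHS]mulrCA ler_pM2l// -expRD ler_expR.
  by rewrite le_eqVlt; apply/orP; left; apply/eqP; field.
rewrite mulr_sumr; apply: ler_sum => x _; rewrite mulrCA ler_wpM2l//.
set z := deviation n s x.
have pos (b sg : bool) : 0 <= expR (tau / 32 * ((-1) ^+ sg * part R b z)).
  exact: expR_ge0.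
case: ltP => [lt_z|_]; last by rewrite mulr0 sumr_ge0// => b _; rewrite sumr_ge0.
rewrite mulr1.
have n0 : 0 <= n%:R :> R by [].
have ntau : 0 <= n%:R * tau by rewrite mulr_ge0//; lra.
have [b hb] : exists b, n%:R * tau / 2 <= `|part R b z|.
  apply: contrapT => nb.
  have lt b : part R b z ^+ 2 < (n%:R * tau / 2) ^+ 2.
    rewrite -real_normK ?num_real// ltr_pXn2r// ?nnegrE//; last lra.
    by rewrite ltNge; apply/negP => h; apply: nb; exists b.
  move: lt_z; rewrite sqn_part big_bool/=.
  by have := lt true; have := lt false => /=; nra.
have [sg hsg] : exists sg : bool, n%:R * tau / 2 <= (-1) ^+ sg * part R b z.
  have [h|h] := leP 0 (part R b z).
    by exists false; rewrite expr0 mul1r; rewrite ger0_norm in hb.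
  by exists true; rewrite expr1 mulN1r; rewrite ltr0_norm in hb.
apply: (@le_trans _ _ (expR (tau / 32 * ((-1) ^+ sg * part R b z)))).
  by rewrite ler_expR ler_wpM2l//; lra.
rewrite (bigD1 b)//= (bigD1 sg)//= -addrA lerDl addr_ge0 ?sumr_ge0//.
by move=> b' _; rewrite sumr_ge0.
Qed.

Lemma maurey_L2_complex (n : nat) (nu : X -> R) : (forall x, 0 <= nu x) ->
  exists s : n.-tuple (I * bool * bool),
    \sum_x nu x * sqn R (deviation n s x) <= 8 * n%:R * \sum_x nu x.
Proof.
move=> nu0; have [w [w0 w1 wE]] := weights.
pose psi a (y : X * bool) : R := part R y.2 (atom a y.1).
have psi1 a y : `|psi a y| <= 1 by rewrite part_le1// sqn_atom.
have [s sP] := maurey_L2 R _ _ w psi w0 w1 psi1 n (fun y => nu y.1)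
  (fun y => nu0 y.1).
exists s; apply: (le_trans (le_trans _ sP)).
  rewrite -(pair_bigA _ (fun x b => nu x * (\sum_(a <- s)
     (\sum_a w a * psi a (x, b) - psi a (x, b))) ^+ 2))/=.
  rewrite le_eqVlt; apply/orP; left; apply/eqP/eq_bigr => x _.
  rewrite sqn_part mulr_sumr; apply: eq_bigr => b _; congr (_ * _ ^+ 2).
  by rewrite part_deviation; apply: eq_bigr => a _; rewrite -wE.
rewrite -(pair_bigA _ (fun x (b : bool) => nu x))/= !mulr_sumr.
apply: ler_sum => x _; by rewrite big_bool/=; lra.
Qed.

End ComplexMaurey.

(** * The lower sampling inequality for sparse sums *)

Section SparseLowerBound.
Variable R : realType.
Local Notation C := R[i].

(** The highest level [i] with [2^i / 2 <= y] has [2^i >= y], so its term alone suffices; with no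
    such level, [y < 1/2]. For [y = |u|^2] of mean [1], the constant uses up only half of the
    mean. *)
Lemma dyadic_layers (L : nat) (y : R) : 0 <= y <= 2 ^+ L ->
  y <= 2^-1 + \sum_(i < L.+1) 2 ^+ i * (2 ^+ i / 2 <= y)%R%:R.
Proof.
elim: L => [|L IH] /andP[y0 yL].
  rewrite big_ord_recl big_ord0 addr0 /= !expr0 !mul1r.
  by rewrite expr0 in yL; case: (leP 2^-1 y) => /= h; lra.
rewrite big_ord_recr/= addrA.
have S0 : 0 <= \sum_(i < L.+1) 2 ^+ i * (2 ^+ i / 2 <= y)%R%:R :> R.
  by apply: sumr_ge0 => i _; rewrite mulr_ge0// exprn_ge0.
case: (leP (2 ^+ L.+1 / 2) y) => h; first by rewrite mulr1; lra.
rewrite mulr0 addr0; apply: IH; rewrite y0/=.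
by move: h; rewrite exprS mulrAC divff// mul1r => /ltW.
Qed.

Variables (I X : finType) (phi : I -> X -> C).
Hypothesis phi_le1 : forall i x, sqn R (phi i x) <= 1.
Hypothesis parseval : forall c : I -> C,
  \sum_x sqn R (\sum_i c i * phi i x) = #|X|%:R * \sum_i sqn R (c i).
Hypotheses (I0 : (0 < #|I|)%N) (X0 : (0 < #|X|)%N).

Let u (c : I -> C) x := \sum_i c i * phi i x.

(** Cauchy-Schwarz on the support, with [(|x| + |y|)^2 <= 2 (x^2 + y^2)]. *)
Lemma sparse_l1_bound (c : I -> C) (v : nat) :
  (#|[pred i | c i != 0%R]| <= v)%N -> \sum_i sqn R (c i) = 1 ->
  \sum_i (`|complex.Re (c i)| + `|complex.Im (c i)|) <= Num.sqrt (2 * v%:R).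
Proof.
move=> cv c1.
pose F i := `|complex.Re (c i)| + `|complex.Im (c i)|.
have F0 i : 0 <= F i by rewrite addr_ge0.
have supp (G : I -> R) : (forall i, c i = 0 -> G i = 0) ->
    \sum_i G i = \sum_(i | c i != 0) G i.
  move=> G0; rewrite [RHS]big_mkcond; apply: eq_bigr => i _.
  by case: eqVneq => // /G0.
rewrite -[leLHS]ger0_norm ?sumr_ge0// -sqrtr_sqr ler_wsqrtr//.
rewrite supp; last by move=> i ->; rewrite /= normr0 addr0.
apply: le_trans (sqr_sum_le _ _ _ _) _; rewrite mulrC.
apply: ler_pM => //.
- by rewrite sumr_ge0// => i _; rewrite sqr_ge0.
- apply: (@le_trans _ _ (2 * \sum_i sqn R (c i))); last by rewrite c1 mulr1.
  rewrite mulr_sumr [leRHS]supp; last by move=> i ->; rewrite sqn0 mulr0.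
  apply: ler_sum => i _; rewrite /sqn -![complex.Re _ ^+ 2]real_normK ?num_real//.
  rewrite -![complex.Im _ ^+ 2]real_normK ?num_real//.
  by have := sqr_ge0 (`|complex.Re (c i)| - `|complex.Im (c i)|); nra.
- by rewrite ler_nat.
Qed.

(** Cauchy-Schwarz on the support again; this is why the levels can stop at [2^L >= v]. *)
Lemma sparse_sup_bound (c : I -> C) (v : nat) x :
  (#|[pred i | c i != 0%R]| <= v)%N -> \sum_i sqn R (c i) = 1 ->
  sqn R (u c x) <= v%:R.
Proof.
move=> cv c1.
have supp : \sum_i sqn R (c i) = \sum_(i | c i != 0) sqn R (c i).
  rewrite [RHS]big_mkcond; apply: eq_bigr => i _.
  by case: eqVneq => // ->; rewrite sqn0.
have suppu : u c x = \sum_(i | c i != 0) c i * phi i x.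
  rewrite [RHS]big_mkcond; apply: eq_bigr => i _.
  by case: eqVneq => // ->; rewrite mul0r.
rewrite suppu sqn_part.
apply: (@le_trans _ _ (\sum_b #|[pred i | c i != 0%R]|%:R *
    \sum_(i | c i != 0) part R b (c i * phi i x) ^+ 2)).
  by apply: ler_sum => b _; rewrite part_sum sqr_sum_le.
rewrite -mulr_sumr exchange_big/= -[leRHS]mulr1 ler_pM ?ler_nat//.
  by apply: sumr_ge0 => i _; apply: sumr_ge0 => b _; rewrite sqr_ge0.
rewrite -c1 supp; apply: ler_sum => i _.
by rewrite -sqn_part sqnM ler_piMr ?sqn_ge0.
Qed.

Section Sampling.
Variables (v L m : nat) (s : nat -> nat).
(** [p i] is the measure that pigeonholing over the [L + 1] levels leaves for level [i]; [s i] is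
    the number of atoms used there. *)
Let p (i : nat) : R := (2 ^+ i)^-1 / (2 * L.+1%:R).
Hypotheses (v0 : (0 < v)%N) (vL : (v <= 2 ^ L)%N) (Lv : (2 ^ L <= 2 * v)%N).
Hypothesis m0 : (0 < m)%N.
Hypothesis s0 : forall i, (i <= L)%N -> (0 < s i)%N.
(** [2^13] results from [tau^2 = 2^i / (64 v)] in the exponent [s tau^2 / 128]; the factor [8] is
    [4] times the mass [2] of the grid and sampling measures together. *)
Hypothesis s_tail : forall i, (i <= L)%N ->
  8 * expR (- ((s i)%:R * 2 ^+ i / (2 ^+ 13 * v%:R))) <= p i / 16.
Hypothesis s_union :
  \sum_(i < L.+1) (4 * #|I|)%:R ^+ s i * expR (- (p i * m%:R / 8)) < 1.

Let p_gt0 i : 0 < p i.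
Proof. by rewrite divr_gt0// ?invr_gt0 ?exprn_gt0// mulr_gt0. Qed.

(** Defined by the atoms alone, so finitely many such sets serve all [u]. The factor [s^2 / (2 v)]
    rescales [|u|^2] to the size of a sum of [s] atoms. By [|z + w|^2 <= 2 |z|^2 + 2 |w|^2], a
    squared deviation of at most [1/16] of the level [T = 2^i / 2] turns [|u|^2 >= T] into
    [7/16 = 1/2 - 1/16], and this back into [5/32 = 7/32 - 1/16]. *)
Let large (i : nat) (al : seq (I * bool * bool)) : pred X := fun x =>
  (s i)%:R ^+ 2 / (2 * v%:R) * (7 / 16 * (2 ^+ i / 2)) <=
  sqn R (\sum_(a <- al) atom R I X phi a x).

Let select_points : exists xi : m.-tuple X,
  forall (i : 'I_L.+1) (al : (s i).-tuple (I * bool * bool)),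
    p i / 2 * #|X|%:R <= #|large i al|%:R ->
    p i / 8 * m%:R <= (count (large i al) xi)%:R.
Proof.
pose Ev := {i : 'I_L.+1 & (s i).-tuple (I * bool * bool)}.
pose big_enough (g : Ev) : bool :=
  p (nat_of_ord (tag g)) / 2 * #|X|%:R <= #|large (tag g) (tagged g)|%:R.
(* Events that are too small are replaced by the sure event. *)
pose E (g : Ev) : pred X := if big_enough g then large (tag g) (tagged g) else predT.
have p1 i : p i / 2 <= 1.
  suff : p i <= 1 by have := p_gt0 i; lra.
  rewrite /p mulr_ile1 ?invr_ge0 ?exprn_ge0 ?mulr_ge0//.
    by rewrite invf_le1 ?exprn_gt0// exprn_ege1// ler1n.
  by rewrite invf_le1 ?mulr_gt0// -natrM ler1n.
have pE g : p (nat_of_ord (tag g)) / 2 * #|X|%:R <= #|E g|%:R.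
  rewrite /E; case: ifP => [//|_].
  rewrite (_ : #|_| = #|X|); last exact: eq_card.
  by rewrite ler_piMl.
have [|xi xiP] := @chernoff_select R X Ev E (fun g => p (nat_of_ord (tag g)) / 2) m X0 pE.
  apply: le_lt_trans s_union.
  rewrite (eq_bigr (fun g : Ev => expR (- (p (nat_of_ord (tag g)) * m%:R / 8)))); last first.
    by move=> g _; congr expR; lra.
  have -> : \sum_(g : Ev) expR (- (p (nat_of_ord (tag g)) * m%:R / 8)) =
      \sum_(i < L.+1) \sum_(al : (s i).-tuple (I * bool * bool))
        expR (- (p i * m%:R / 8)) by apply/esym; rewrite sig_big_dep.
  apply: ler_sum => i _; rewrite sumr_const.
  rewrite card_tuple !card_prod card_bool -mulnA (mulnC #|I|).
  by rewrite -natrX mulr_natl.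
exists xi => i al h.
have := xiP (Tagged (fun i : 'I_L.+1 => (s i).-tuple (I * bool * bool)) al).
rewrite /E /big_enough/= h => h'; apply: le_trans h'.
by rewrite le_eqVlt; apply/orP; left; apply/eqP; lra.
Qed.

Lemma sparse_lower_unit : exists xi : m.-tuple X,
  forall c : I -> C, (#|[pred i | c i != 0%R]| <= v)%N -> \sum_i sqn R (c i) = 1 ->
  1 <= 512 * L.+1%:R * (m%:R^-1 * \sum_(x <- xi) sqn R (u c x)).
Proof.
have [xi xiP] := select_points.
exists xi => c cv c1.
have nX0 : 0 < #|X|%:R :> R by rewrite ltr0n.
have nm0 : 0 < m%:R :> R by rewrite ltr0n.
have nv0 : 0 < v%:R :> R by rewrite ltr0n.
have nL0 : 0 < L.+1%:R :> R by rewrite ltr0n.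
have e2 k : 0 < 2 ^+ k :> R by rewrite exprn_gt0.
(* Pigeonhole over the levels: by Parseval, the measures of the level sets weighted by [2^i] add up
   to at least [1/2], so one product is at least [1 / (2 (L + 1))]. Signs are flipped because
   [exists_le_avg] yields upper bounds. *)
have [i iP] : exists i : 'I_L.+1,
    p i * #|X|%:R <= \sum_x (2 ^+ i / 2 <= sqn R (u c x))%R%:R.
  have [|i iP] := @exists_le_avg R 'I_L.+1
    (fun i => - (2 ^+ i * \sum_x (2 ^+ i / 2 <= sqn R (u c x))%R%:R))
    (- (#|X|%:R / (2 * L.+1%:R))) (ltac:(by rewrite card_ord)).
    rewrite card_ord sumrN mulrN lerN2.
    have -> : L.+1%:R * (#|X|%:R / (2 * L.+1%:R)) = #|X|%:R / 2 :> R.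
      by field; rewrite gt_eqF.
    have : (#|X|%:R : R) <= \sum_x (2^-1 + \sum_(i < L.+1) 2 ^+ i *
        (2 ^+ i / 2 <= sqn R (u c x))%R%:R).
      apply: (@le_trans _ _ (\sum_x sqn R (u c x))).
        by rewrite parseval c1 mulr1.
      apply: ler_sum => x _.
      apply: dyadic_layers; rewrite sqn_ge0/=.
      apply: le_trans (sparse_sup_bound c v x cv c1) _.
      by rewrite -natrX ler_nat.
    rewrite big_split/= sumr_const exchange_big/=.
    under [X in _ <= _ + X -> _]eq_bigr do rewrite -mulr_sumr.
    by rewrite -[2^-1 *+ _]mulr_natl; lra.
  exists i; move: iP; rewrite lerN2 /p => iP.
  rewrite -(ler_pM2l (e2 i)); apply: le_trans iP.
  rewrite le_eqVlt; apply/orP; left; apply/eqP; field.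
  by rewrite !gt_eqF.
set T : R := 2 ^+ i / 2 in iP *.
have T0 : 0 < T by rewrite divr_gt0.
have iL : (i <= L)%N by rewrite -ltnS.
have ns0 : 0 < (s i)%:R :> R by rewrite ltr0n s0.
pose A0 := Num.sqrt (2 * v%:R) : R.
have A00 : 0 < A0 by rewrite sqrtr_gt0 mulr_gt0.
have A0sq : A0 ^+ 2 = 2 * v%:R by rewrite sqr_sqrtr// mulr_ge0.
pose tau := Num.sqrt (T / (32 * v%:R)).
have tausq : tau ^+ 2 = T / (32 * v%:R).
  by rewrite sqr_sqrtr// divr_ge0 ?mulr_ge0// ltW.
have tau8 : 0 <= tau <= 8.
  rewrite sqrtr_ge0/= -(@ler_pXn2r _ 2)// ?nnegrE ?sqrtr_ge0// tausq.
  have TL : T <= v%:R.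
    rewrite /T ler_pdivrMr// mulrC -natrM -natrX ler_nat (leq_trans _ Lv)//.
    by rewrite leq_exp2l.
  by rewrite ler_pdivrMr ?mulr_gt0//; nra.
(* Grid measure plus sampling measure. The points [xi] are already fixed; the atoms chosen next may
   depend on them because [xiP] covers all tuples. *)
pose nu x : R := #|X|%:R^-1 + (count_mem x xi)%:R / m%:R.
have nu0 x : 0 <= nu x by rewrite addr_ge0// ?divr_ge0// invr_ge0.
have nuE (F : X -> R) : \sum_x nu x * F x =
    #|X|%:R^-1 * \sum_x F x + m%:R^-1 * \sum_(x <- xi) F x.
  rewrite -(sum_count_mem R X xi) !mulr_sumr -big_split/=; apply: eq_bigr => x _.
  by rewrite /nu; ring.
have sum_nu : \sum_x nu x = 2.
  rewrite (eq_bigr (fun x => nu x * 1)); last by move=> x _; rewrite mulr1.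
  rewrite nuE sumr_const big_const_seq count_predT size_tuple iter_addr_0.
  by rewrite !mulVf// gt_eqF.
have [al alP] := maurey_tail R I X phi phi_le1 I0 c A0 A00
  (sparse_l1_bound c v cv c1) tau (s i) nu tau8 nu0.
rewrite sum_nu in alP.
set D := deviation R I X phi c A0 (s i) al in alP.
pose bad x := (s i)%:R ^+ 2 * tau ^+ 2 < sqn R (D x).
have {alP}nu_bad : \sum_x nu x * (bad x)%:R <= p i / 16.
  apply: le_trans alP _; apply: le_trans (s_tail i iL).
  rewrite mulrAC (_ : 4 * 2 = 8) ?natrM; last by lra.
  rewrite ler_pM2l// ler_expR lerN2 tausq /T.
  rewrite le_eqVlt; apply/orP; left; apply/eqP; field.
  by rewrite gt_eqF.
pose at_ x := \sum_(a <- al) atom R I X phi a x.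
have uD x : (s i)%:R ^+ 2 / (2 * v%:R) * sqn R (u c x) = sqn R (at_ x + D x).
  rewrite /D /deviation addrC subrK sqnM sqn_real -A0sq.
  by rewrite exprMn exprVn.
set r : R := (s i)%:R ^+ 2 / (2 * v%:R) in uD.
have r0 : 0 < r by rewrite divr_gt0 ?exprn_gt0 ?mulr_gt0.
have rT : (s i)%:R ^+ 2 * tau ^+ 2 = r * (T / 16).
  by rewrite tausq /r; field; rewrite gt_eqF.
have good1 x : (T <= sqn R (u c x))%R%:R <= (large i al x)%:R + (bad x)%:R :> R.
  case: (leP T (sqn R (u c x))) => [hT|_]; last by rewrite addr_ge0.
  rewrite /bad; case: (ltP _ (sqn R (D x))) => [_|hb]; first by rewrite lerDr.
  rewrite /large -/r -/T -/(at_ x).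
  suff -> : r * (7 / 16 * T) <= sqn R (at_ x) by rewrite addr0.
  have := sqnD_le R (at_ x) (D x); rewrite -uD; rewrite rT in hb.
  have : r * T <= r * sqn R (u c x) by rewrite ler_pM2l.
  by lra.
have good2 x : (large i al x)%:R <=
    (5 / 32 * T <= sqn R (u c x))%R%:R + (bad x)%:R :> R.
  rewrite /large -/r -/T -/(at_ x).
  case: (leP (r * (7 / 16 * T)) (sqn R (at_ x))) => [hT|_]; last by rewrite addr_ge0.
  rewrite /bad; case: (ltP _ (sqn R (D x))) => [_|hb]; first by rewrite lerDr.
  suff -> : 5 / 32 * T <= sqn R (u c x) by rewrite addr0.
  have := sqnB_le R (at_ x + D x) (D x); rewrite addrK -uD; rewrite rT in hb.
  by rewrite -[5 / 32 * T <= _](ler_pM2l r0) => h; lra.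
have badX : #|X|%:R^-1 * \sum_x (bad x)%:R <= p i / 16.
  apply: le_trans nu_bad; rewrite nuE lerDl mulr_ge0 ?invr_ge0// sumr_ge0//.
have badm : m%:R^-1 * \sum_(x <- xi) (bad x)%:R <= p i / 16.
  apply: le_trans nu_bad; rewrite nuE lerDr mulr_ge0 ?invr_ge0// sumr_ge0//.
have largeX : p i / 2 * #|X|%:R <= #|large i al|%:R.
  have -> : #|large i al|%:R = \sum_x (large i al x)%:R :> R.
    rewrite -sum1_card natr_sum big_mkcond/=; apply: eq_bigr => x _.
    by rewrite -[x \in _]/(large i al x); case: (large i al x).
  have : \sum_x (T <= sqn R (u c x))%R%:R <=
      \sum_x ((large i al x)%:R + (bad x)%:R) :> R by apply: ler_sum => x _.
  rewrite big_split/= => h; move: badX; rewrite mulrC ler_pdivrMr// => badX.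
  have := p_gt0 i; nra.
have := xiP i al largeX.
rewrite -sum1_count natr_sum big_mkcond/= => largem.
have largem2 : p i / 8 * m%:R <= \sum_(x <- xi) (large i al x)%:R.
  apply: le_trans largem _; apply: ler_sum => x _; by case: (large i al x).
have : \sum_(x <- xi) (large i al x)%:R <=
    \sum_(x <- xi) ((5 / 32 * T <= sqn R (u c x))%R%:R + (bad x)%:R) :> R.
  by apply: ler_sum => x _.
rewrite big_split/= => h.
have hT : 5 / 32 * T * \sum_(x <- xi) (5 / 32 * T <= sqn R (u c x))%R%:R <=
    \sum_(x <- xi) sqn R (u c x).
  rewrite mulr_sumr; apply: ler_sum => x _.
  case: (leP (5 / 32 * T) (sqn R (u c x))) => h' /=; first by rewrite mulr1.
  by rewrite mulr0 sqn_ge0.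
move: badm; rewrite mulrC ler_pdivrMr// => badm.
have hp : p i / 16 * m%:R <= \sum_(x <- xi) (5 / 32 * T <= sqn R (u c x))%R%:R by lra.
have h5 : 5 / 32 * T * (p i / 16 * m%:R) <= \sum_(x <- xi) sqn R (u c x).
  by apply: le_trans hT; rewrite ler_pM2l// mulr_gt0.
have -> : 512 * L.+1%:R * (m%:R^-1 * \sum_(x <- xi) sqn R (u c x)) =
  (512 * L.+1%:R / m%:R) * \sum_(x <- xi) sqn R (u c x) by ring.
have k512 : 0 < 512 :> R by rewrite ltr0n.
have k0 : 0 < 512 * L.+1%:R / m%:R :> R by exact: divr_gt0 (mulr_gt0 k512 nL0) nm0.
apply: (@le_trans _ _ (512 * L.+1%:R / m%:R * (5 / 32 * T * (p i / 16 * m%:R)))); last first.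
  by rewrite ler_pM2l.
(* Here [T * p i = 1 / (4 (L + 1))], so the product is [512 * 5 / 2048]. *)
have -> : 512 * L.+1%:R / m%:R * (5 / 32 * T * (p i / 16 * m%:R)) = 5 / 4 :> R.
  by rewrite /T /p; field; rewrite !gt_eqF.
lra.
Qed.

Lemma sparse_lower : exists xi : m.-tuple X,
  forall c : I -> C, (#|[pred i | c i != 0%R]| <= v)%N ->
  \sum_i sqn R (c i) <= 512 * L.+1%:R * (m%:R^-1 * \sum_(x <- xi) sqn R (u c x)).
Proof.
have [xi xiP] := sparse_lower_unit; exists xi => c cv.
set S := \sum_i sqn R (c i).
have S0 : 0 <= S by apply: sumr_ge0 => i _; exact: sqn_ge0.
have [->|Sn0] := eqVneq S 0.
  apply: mulr_ge0; first by rewrite -natrM ler0n.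
  by rewrite mulr_ge0 ?invr_ge0 ?ler0n// sumr_ge0// => x _; exact: sqn_ge0.
have {Sn0}S0 : 0 < S by rewrite lt_neqAle eq_sym Sn0.
pose k : R := (Num.sqrt S)^-1.
have ksq : k ^+ 2 = S^-1 by rewrite exprVn sqr_sqrtr// ltW.
have := xiP (fun i => k%:C%C * c i).
have uk x : sqn R (u (fun i => k%:C%C * c i) x) = S^-1 * sqn R (u c x).
  rewrite -ksq -sqn_real -sqnM /u mulr_sumr; congr sqn; apply: eq_bigr => i _.
  by rewrite mulrA.
rewrite [X in _ <= _ * (_ * X)](eq_bigr _ (fun x _ => uk x)).
rewrite -[X in _ <= _ * (_ * X)]mulr_sumr => h.
rewrite -(@ler_pM2l _ S^-1) ?invr_gt0//.
rewrite mulVf ?gt_eqF//.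
have -> : S^-1 * (512 * L.+1%:R * (m%:R^-1 * \sum_(x <- xi) sqn R (u c x))) =
  512 * L.+1%:R * (m%:R^-1 * (S^-1 * \sum_(x <- xi) sqn R (u c x))) by ring.
apply: h.
  apply: leq_trans cv; apply/subset_leq_card/fintype.subsetP => i; rewrite !inE.
  by apply: contraNN => /eqP ->; rewrite mulr0.
under eq_bigr do rewrite sqnM sqn_real ksq.
by rewrite -mulr_sumr mulVf// gt_eqF.
Qed.

End Sampling.
End SparseLowerBound.

(** * Lengths of the averages and size of the sample *)

Section SparseSampling.
Variable R : realType.
Local Notation C := R[i].

Lemma ln2_ge : 2^-1 <= ln 2 :> R.
Proof.
rewrite -ler_expR lnK ?posrE//.
have h : 2^-1 <= expR (- 2^-1) :> R by have := expR_ge1Dx (- 2^-1 : R); lra.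
rewrite -[leLHS]invrK -expRN -[leRHS]invrK lef_pV2// ?posrE ?invr_gt0// expR_gt0.
Qed.

Lemma ln_double_ge1 (v : nat) : (2 <= v)%N -> 1 <= ln (2 * v%:R) :> R.
Proof.
move=> v2; have v2' : 2 <= v%:R :> R by rewrite ler_nat.
apply: (@le_trans _ _ (ln 2 + ln 2)); first by have := ln2_ge; lra.
rewrite -lnM ?posrE// ler_ln ?posrE ?mulr_gt0//; lra.
Qed.

(** [7 * 2^13] bounds [s i] in units of [v ln (2v) / 2^i]; [48 = 16 * 3] comes from [p i / 8] and
    [L + 1 <= 3 ln (2v)]. *)
Definition sampling_rate : R := 48 * (7 * 2 ^+ 13).

(** [512 * 3], again by [L + 1 <= 3 ln (2v)]. *)
Definition sampling_loss : R := 1536.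

Lemma sampling_rate_gt0 : 0 < sampling_rate.
Proof. by rewrite /sampling_rate !mulr_gt0 ?exprn_gt0 ?ltr0n. Qed.

Lemma sampling_loss_ge0 : 0 <= sampling_loss.
Proof. exact: ler0n. Qed.

Variables (I X : finType) (phi : I -> X -> C).
Hypothesis phi_le1 : forall i x, sqn R (phi i x) <= 1.
Hypothesis parseval : forall c : I -> C,
  \sum_x sqn R (\sum_i c i * phi i x) = #|X|%:R * \sum_i sqn R (c i).
Hypotheses (I0 : (0 < #|I|)%N) (X0 : (0 < #|X|)%N).

Lemma sparse_sampling (B : R) (v m : nat) : (2 <= v)%N -> 0 <= B ->
  ln (4 * #|I|)%:R <= B * ln (2 * v%:R) ->
  sampling_rate * (B + 3) * v%:R * ln (2 * v%:R) ^+ 3 <= m%:R ->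
  exists xi : m.-tuple X,
  forall c : I -> C, (#|[pred i | c i != 0%R]| <= v)%N ->
  \sum_i sqn R (c i) <= sampling_loss * ln (2 * v%:R) *
     (m%:R^-1 * \sum_(x <- xi) sqn R (\sum_i c i * phi i x)).
Proof.
rewrite /sampling_rate /sampling_loss => v2 B0 lnI.
have K2 : 2 <= 2 ^+ 13 :> R by rewrite -[leLHS]expr1 ler_weXn2l// ler1n.
move: K2 (@sparse_lower R I X phi phi_le1 parseval I0 X0 v).
set K : R := 2 ^+ 13; clearbody K => K2 lower mP.
have l1 := ln_double_ge1 v v2.
set l := ln _ in l1 lnI mP *.
have v0 : (0 < v)%N by apply: leq_trans v2.
have vR0 : 2 <= v%:R :> R by rewrite ler_nat.
have w0 : (0 < 2 * v)%N by rewrite muln_gt0.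
have [Lv vL] : (2 ^ trunc_log 2 (2 * v) <= 2 * v)%N /\
    (v <= 2 ^ trunc_log 2 (2 * v))%N.
  have /andP[h1 h2] := @trunc_log_bounds 2 (2 * v) isT w0.
  by split=> //; rewrite expnS ltn_pmul2l// in h2; exact: ltnW.
set L := trunc_log 2 (2 * v) in Lv vL.
have e2 k : 0 < 2 ^+ k :> R by rewrite exprn_gt0.
have expl : expR l = 2 * v%:R by rewrite lnK ?posrE ?mulr_gt0//; lra.
have L3 : L.+1%:R <= 3 * l.
  have : L%:R * ln 2 <= l :> R.
    rewrite -ler_expR expl expRM_natl lnK ?posrE//.
    by rewrite -natrX -natrM ler_nat.
  have := ln2_ge; rewrite -(natr1 L); have : 0 <= L%:R :> R by []; nra.
(* The [6] makes the tail [exp (-6 l) = (2 v)^-6]: one power of [2 v] pays for [2^i], one for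
   [L + 1] and four for the constant [256]. For [i <= L] one has [2^i <= 2 v], so rounding up costs
   at most one more unit, hence the [7] in [s_le]. *)
pose s i := (Num.truncn (6 * K * v%:R * l / 2 ^+ i)).+1.
have s_ge i : 6 * K * v%:R * l / 2 ^+ i <= (s i)%:R by exact/ltW/truncnS_gt.
have s_le i : (i <= L)%N -> (s i)%:R <= 7 * K * v%:R * l / 2 ^+ i.
  move=> iL; rewrite /s -(natr1 (Num.truncn _)).
  have a0 : 0 <= 6 * K * v%:R * l / 2 ^+ i by rewrite divr_ge0 ?mulr_ge0//; lra.
  apply: (@le_trans _ _ (6 * K * v%:R * l / 2 ^+ i + 1)).
    by rewrite lerD2r truncn_le.
  have : 1 <= 2 * v%:R * l / 2 ^+ i.
    rewrite ler_pdivlMr// mul1r.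
    apply: (@le_trans _ _ (2 * v%:R)); last by rewrite ler_peMr//; lra.
    by rewrite -natrX -natrM ler_nat (leq_trans _ Lv)// leq_exp2l.
  have -> : 7 * K * v%:R * l / 2 ^+ i =
    6 * K * v%:R * l / 2 ^+ i + K / 2 * (2 * v%:R * l / 2 ^+ i).
    by field; rewrite gt_eqF.
  by set q := 2 * v%:R * l / 2 ^+ i; nra.
have m0 : (0 < m)%N.
  rewrite -(ltr0n R); apply: lt_le_trans mP.
  by rewrite !mulr_gt0 ?exprn_gt0//; lra.
have tail i : (i <= L)%N -> 8 * expR (- ((s i)%:R * 2 ^+ i / (K * v%:R))) <=
    (2 ^+ i)^-1 / (2 * L.+1%:R) / 16.
  move=> iL; apply: (@le_trans _ _ (8 * expR (- (6 * l)))).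
    rewrite ler_pM2l// ler_expR lerN2 ler_pdivlMr; last by rewrite mulr_gt0//; lra.
    have := s_ge i; rewrite ler_pdivrMr// => h; apply: le_trans h.
    by rewrite le_eqVlt; apply/orP; left; apply/eqP; ring.
  have -> : (2 ^+ i)^-1 / (2 * L.+1%:R) / 16 = (32 * (2 ^+ i * L.+1%:R))^-1 :> R.
    by field; rewrite !gt_eqF.
  rewrite expRN -[8]invrK -invfM lef_pV2 ?posrE ?mulr_gt0 ?expR_gt0//.
  have -> : expR (6 * l) = (2 * v%:R) ^+ 6 by rewrite expRM_natl expl.
  rewrite [leRHS]mulrC ler_pdivlMr//.
  have : (2 ^ i * L.+1 * 256 <= (2 * v) ^ 6)%N.
    have -> : ((2 * v) ^ 6 = (2 * v) * (2 * v) * (2 * v) ^ 4)%N by rewrite -mulnA -!expnS.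
    rewrite !leq_mul//.
    - by rewrite (leq_trans _ Lv)// leq_exp2l.
    - by rewrite (leq_trans _ Lv)// ltn_expl.
    - by rewrite (_ : 256 = 4 ^ 4)%N// leq_exp2r// (leq_mul2l 2 2).
  rewrite -(ler_nat R) natrX !natrM natrX; lra.
have union : \sum_(i < L.+1) (4 * #|I|)%:R ^+ s i *
    expR (- ((2 ^+ i)^-1 / (2 * L.+1%:R) * m%:R / 8)) < 1 :> R.
  (* Each level keeps a reserve [exp (-3 l)], and there are at most [3 l] levels. *)
  apply: (@le_lt_trans _ _ (\sum_(i < L.+1) expR (- (3 * l)))).
    apply: ler_sum => i _; have iL : (i <= L)%N by rewrite -ltnS.
    have N0 : 0 < (4 * #|I|)%:R :> R by rewrite ltr0n muln_gt0.
    rewrite -[_%:R in leLHS](lnK _) ?posrE// -expRM_natl -expRD ler_expR.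
    have ms : (s i)%:R * ln (4 * #|I|)%:R <= (s i)%:R * (B * l) by rewrite ler_wpM2l.
    have s1 : 1 <= (s i)%:R :> R by rewrite ler1n.
    have h1 : (s i)%:R * (B * l) + 3 * l <= (s i)%:R * ((B + 3) * l) by nra.
    have h2 : (s i)%:R * ((B + 3) * l) <= 7 * K * v%:R * l / 2 ^+ i * ((B + 3) * l).
      by rewrite ler_wpM2r ?s_le// mulr_ge0//; lra.
    have h3 : 7 * K * v%:R * l / 2 ^+ i * ((B + 3) * l) <=
        (2 ^+ i)^-1 / (2 * L.+1%:R) * m%:R / 8.
      have -> : 7 * K * v%:R * l / 2 ^+ i * ((B + 3) * l) =
          (2 ^+ i)^-1 * (7 * K * v%:R * (B + 3) * l ^+ 2) by ring.
      rewrite -!(mulrA (2 ^+ i)^-1) ler_pM2l ?invr_gt0//.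
      have -> : (2 * L.+1%:R)^-1 * m%:R / 8 = m%:R / (16 * L.+1%:R) :> R.
        by field; rewrite gt_eqF.
      rewrite ler_pdivlMr ?mulr_gt0//; apply: le_trans mP.
      have -> : 48 * (7 * K) * (B + 3) * v%:R * l ^+ 3 =
        7 * K * v%:R * (B + 3) * l ^+ 2 * (16 * (3 * l)) by ring.
      apply: ler_wpM2l; last by rewrite ler_pM2l.
      have K0 : 0 <= 7 * K by lra.
      have B3 : 0 <= B + 3 by lra.
      exact: mulr_ge0 (mulr_ge0 (mulr_ge0 K0 (ler0n _ _)) B3) (sqr_ge0 _).
    rewrite lerBlDl -lerBlDr opprK.
    by apply: le_trans (le_trans h2 h3); apply: le_trans h1; rewrite lerD2r.
  rewrite sumr_const card_ord -[expR _ *+ _]mulr_natl expRN ltr_pdivrMr ?expR_gt0// mul1r.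
  by have := expR_ge1Dx (3 * l); lra.
have [xi xiP] := lower L m s v0 vL Lv m0
  (fun i _ => isT) tail union.
exists xi => c cv; apply: le_trans (xiP c cv) _.
apply: ler_wpM2r; last by lra.
by rewrite mulr_ge0 ?invr_ge0// sumr_ge0// => x _; exact: sqn_ge0.
Qed.

End SparseSampling.

(** * Trigonometric polynomials *)

Definition zerok d (k : d.-tuple int) : bool := [forall i, tnth k i == 0].

Arguments zerok {d} k.

Section TrigPoly.
Variable R : realType.
Local Notation C := R[i].
Local Notation mu := (@lebesgue_measure R).
Local Notation e := (cexpi R).

Lemma cexpiD s t : e (s + t) = e s * e t.
Proof.
apply/eqP; rewrite eq_complex /cexpi/= sinD cosD.
by apply/andP; split; apply/eqP; ring.
Qed.

Lemma cexpi0 : e 0 = 1.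
Proof. by apply/eqP; rewrite eq_complex /cexpi/= sin0 cos0 !eqxx. Qed.

Lemma sqn_cexpi t : sqn R (e t) = 1.
Proof. by rewrite /sqn/= cos2Dsin2. Qed.

Lemma cabs_cexpi t : cabs R (e t) = 1.
Proof. by rewrite /cabs/= cos2Dsin2 sqrtr1. Qed.

Lemma cexpi_sum (T : Type) (s : seq T) (F : T -> R) :
  e (\sum_(i <- s) F i) = \prod_(i <- s) e (F i).
Proof.
elim: s => [|a s IH]; first by rewrite !big_nil cexpi0.
by rewrite !big_cons cexpiD IH.
Qed.

Lemma cexpi_mulrn t n : e (t *+ n) = e t ^+ n.
Proof.
elim: n => [|n IH]; first by rewrite mulr0n cexpi0 expr0.
by rewrite mulrS cexpiD IH exprS.
Qed.

Lemma cexpiNr t : e (- t) * e t = 1.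
Proof. by rewrite -cexpiD addNr cexpi0. Qed.

Lemma conj_cexpi t : (e t)^*%C = e (- t).
Proof. by apply/eqP; rewrite eq_complex /cexpi/= sinN cosN !eqxx. Qed.

Lemma cexpi_2pi_int (n : int) : e (n%:~R * (2 * pi)) = 1.
Proof.
have pos (k : nat) : e (k%:R * (2 * pi)) = 1.
  rewrite mulr_natl cexpi_mulrn (_ : e _ = 1) ?expr1n//.
  rewrite [2 * pi](_ : _ = pi *+ 2) ?mulr_natl//.
  by apply/eqP; rewrite eq_complex /cexpi/= cos2pi sin2pi !eqxx.
case: n => k; first exact: pos.
by rewrite NegzE mulrNz mulNr -[LHS]mulr1 -(pos k.+1) cexpiNr.
Qed.

(** The cosine is that of [2 th] with [0 < th < pi], so [cos (2 th) = 1 - 2 sin^2 th < 1]. *)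
Lemma cexpi_neq1 (n : int) (Q : nat) : n != 0 -> (`|n| < Q)%N ->
  e (n%:~R * (2 * pi / Q%:R)) != 1.
Proof.
move=> n0 nQ; rewrite eq_complex negb_and; apply/orP; left; rewrite /cexpi/=.
have Q0 : 0 < Q%:R :> R by rewrite ltr0n (leq_ltn_trans _ nQ).
pose th : R := `|n|%N%:R * pi / Q%:R.
have -> : cos (n%:~R * (2 * pi / Q%:R)) = cos (th *+ 2).
  rewrite /th; case: n n0 nQ {th} => k _ _.
    by rewrite -mulr_natl; congr cos; rewrite absz_nat; ring.
  rewrite NegzE mulrNz mulNr cosN abszN absz_nat -mulr_natl.
  by congr cos; ring.
rewrite cos_mulr2n; apply/negP => /eqP h.
have s0 : 0 < sin th.
  apply: sin_gt0_pi; rewrite /th; apply/andP; split.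
    by rewrite divr_gt0// mulr_gt0 ?pi_gt0// ltr0n absz_gt0.
  by rewrite ltr_pdivrMr// mulrC ltr_pM2l ?pi_gt0// ltr_nat.
have := cos2Dsin2 th; have : 0 < sin th ^+ 2 by rewrite exprn_gt0.
by rewrite mulr2n in h; nra.
Qed.

Lemma sum_cexpi_grid (n : int) (Q : nat) : (`|n| < Q)%N ->
  \sum_(q < Q) e (n%:~R * (2 * pi * q%:R / Q%:R)) = if n == 0 then Q%:R else 0.
Proof.
move=> nQ; have Q0 : Q%:R != 0 :> R by rewrite pnatr_eq0 -lt0n (leq_ltn_trans _ nQ).
case: eqVneq => [->|n0].
  under eq_bigr do rewrite mulr0z mul0r cexpi0.
  by rewrite sumr_const card_ord.
set z := e (n%:~R * (2 * pi / Q%:R)).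
rewrite (eq_bigr (fun q : 'I_Q => z ^+ q)); last first.
  by move=> q _; rewrite /z -cexpi_mulrn -mulr_natl; congr e; ring.
have z1 : z - 1 != 0 by rewrite subr_eq0 cexpi_neq1.
apply: (mulfI z1); rewrite -subrX1 mulr0 /z -cexpi_mulrn.
rewrite [X in e X](_ : _ = n%:~R * (2 * pi)) ?cexpi_2pi_int ?subrr//.
by rewrite -[LHS]mulr_natl; field.
Qed.

Section Grid.
Variables (d Q : nat).

Definition gridpt (q : {ffun 'I_d -> 'I_Q}) : d.-tuple R :=
  [tuple 2 * pi * (q i)%:R / Q%:R | i < d].

Lemma gridpt_torus q : torus R d (gridpt q).
Proof.
move=> i; rewrite tnth_mktuple; have qQ := ltn_ord (q i).
have Q0 : 0 < Q%:R :> R by rewrite ltr0n (leq_ltn_trans _ qQ).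
rewrite divr_ge0 ?mulr_ge0 ?pi_ge0//=.
by rewrite ltr_pdivrMr// ltr_pM2l ?mulr_gt0 ?pi_gt0// ltr_nat.
Qed.

Lemma sum_grid_character (k : d.-tuple int) :
  (forall i, (`|tnth k i| < Q)%N) ->
  \sum_q e (dotk R d k (gridpt q)) = if zerok k then Q%:R ^+ d else 0.
Proof.
move=> kQ.
under eq_bigr => q _.
  rewrite /dotk cexpi_sum.
  under eq_bigr do rewrite tnth_mktuple.
  over.
rewrite -(bigA_distr_bigA (fun (i : 'I_d) (q : 'I_Q) =>
   e ((tnth k i)%:~R * (2 * pi * q%:R / Q%:R))))/=.
under eq_bigr do rewrite sum_cexpi_grid//.
rewrite /zerok; case: forallP => [k0|nk].
  by under eq_bigr do rewrite k0; rewrite prodr_const card_ord.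
have /existsP[i ki] : [exists i, tnth k i != 0].
  by rewrite -negb_forall; apply/forallP.
by rewrite (bigD1 i)//= (negbTE ki) mul0r.
Qed.

Lemma grid_quadrature (T : Type) (r : seq T) (b : T -> C) (k : T -> d.-tuple int) :
  (forall t i, (`|tnth (k t) i| < Q)%N) ->
  \sum_q complex.Re (\sum_(t <- r) b t * e (dotk R d (k t) (gridpt q))) =
  Q%:R ^+ d * complex.Re (\sum_(t <- r | zerok (k t)) b t).
Proof.
move=> kQ; rewrite -Re_sum exchange_big/=.
under eq_bigr do rewrite -mulr_sumr sum_grid_character//.
rewrite [in RHS]big_mkcond/= -[RHS](part_realM R true) /=.
rewrite mulr_sumr; congr complex.Re; apply: eq_bigr => t _.
by case: ifP => _; rewrite ?mulr0// mulrC rmorphXn/= rmorph_nat.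
Qed.

End Grid.

Section OneDim.

(** The real part of [(al + i be) e^(i n t)]. Differentiation multiplies [al + i be] by [i n], so
    the family is closed under it. *)
Definition tterm (al be : R) (n : int) (t : R) : R :=
  al * cos (n%:~R * t) - be * sin (n%:~R * t).

Lemma Re_cexpi (b : C) (n : int) t :
  complex.Re (b * e (n%:~R * t)) = tterm (complex.Re b) (complex.Im b) n t.
Proof. by case: b => x y; rewrite /tterm/=. Qed.

Lemma is_deriveMc (f : R -> R) (c df t : R) :
  is_derive t (1 : R) f df -> is_derive t (1 : R) (fun s => c * f s) (c * df).
Proof. by move=> h; exact: (is_deriveZ c h). Qed.

Lemma is_derive_tterm al be n (t : R) :
  is_derive t (1 : R) (tterm al be n) (tterm (- be * n%:~R) (al * n%:~R) n t).
Proof.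
have dl := is_deriveMc _ n%:~R _ _ (is_derive_id t (1 : R)).
have dc := is_deriveMc _ al _ _ (is_derive1_comp (is_derive_cos _) dl).
have ds := is_deriveMc _ be _ _ (is_derive1_comp (is_derive_sin _) dl).
apply: (is_derive_eq (is_deriveB dc ds)).
by rewrite /tterm/=; ring.
Qed.

Lemma is_derive_sumseq (T : Type) (r : seq T) (f df : T -> R -> R) (t : R) :
  (forall i, is_derive t (1 : R) (f i) (df i t)) ->
  is_derive t (1 : R) (fun t => \sum_(i <- r) f i t) (\sum_(i <- r) df i t).
Proof.
move=> fd; elim: r => [|i r IH].
  rewrite big_nil (_ : (fun _ => _) = cst 0); first exact: is_derive_cst.
  by apply/funext => s; rewrite big_nil.
rewrite big_cons (_ : (fun _ => _) = f i \+ (fun t => \sum_(i <- r) f i t)).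
  exact: is_deriveD.
by apply/funext => s; rewrite big_cons.
Qed.

(** Explicit primitives: the coefficient is divided by [i n] when [n != 0], and the primitive is
    [Re b * t] when [n = 0], where the added [tterm] vanishes identically. By periodicity only the
    latter terms contribute. *)
Lemma integral_trig (T : Type) (r : seq T) (b : T -> C) (n : T -> int) :
  (\int[mu]_(t in I02pi R)
     (complex.Re (\sum_(i <- r) b i * e ((n i)%:~R * t)))%:E =
   (2 * pi * complex.Re (\sum_(i <- r | n i == 0) b i))%:E)%E.
Proof.
pose f i := tterm (complex.Re (b i)) (complex.Im (b i)) (n i).
pose h t : R := \sum_(i <- r) f i t.
pose G i t : R := if n i == 0 then tterm 0 (- complex.Re (b i)) 0 t +
     complex.Re (b i) * t else
   tterm (complex.Im (b i) / (n i)%:~R) (- complex.Re (b i) / (n i)%:~R) (n i) t.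
have dG i t : is_derive t (1 : R) (G i) (f i t).
  rewrite /G /f; case: eqVneq => [->|n0].
    have dl := is_deriveMc _ (complex.Re (b i)) _ _ (is_derive_id t (1 : R)).
    apply: (is_derive_eq (is_deriveD (is_derive_tterm _ _ _ _) dl)).
    by rewrite /tterm !mulr0z !mul0r cos0 sin0; ring.
  apply: (is_derive_eq (is_derive_tterm _ _ _ _)).
  have n0' : (n i)%:~R != 0 :> R by rewrite intr_eq0.
  by congr tterm; field.
have dF t := is_derive_sumseq T r G f t (fun i => dG i t).
have ch : continuous h.
  move=> t; apply/differentiable_continuous/derivable1_diffP.
  pose df i := tterm (- complex.Im (b i) * (n i)%:~R)
    (complex.Re (b i) * (n i)%:~R) (n i).
  by have [] := is_derive_sumseq T r f df t (fun i => is_derive_tterm _ _ _ t).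
under eq_integral => t _.
  rewrite Re_sum.
  under eq_bigr do rewrite Re_cexpi.
  over.
rewrite /I02pi integral_itv_bndo_bndc; last first.
  apply/measurable_realfun.measurable_EFinP; apply: measurable_funTS.
  exact: (measurable_realfun.continuous_measurable_fun ch).
have pi2 : 0 < 2 * pi :> R by rewrite mulr_gt0// pi_gt0.
have cF : continuous (fun t => \sum_(i <- r) G i t).
  move=> t; apply/differentiable_continuous/derivable1_diffP.
  by have [] := dF t.
rewrite (@continuous_FTC2 _ h (fun t => \sum_(i <- r) G i t))//; last first.
- by move=> t _; rewrite derive1E; have [_ ->] := dF t.
- split.
  + by move=> t _; have [] := dF t.
  + exact/cvg_at_right_filter/cF.
  + exact/cvg_at_left_filter/cF.
- exact: continuous_subspaceT.
rewrite -EFinB -sumrB; congr EFin; rewrite Re_sum mulr_sumr [RHS]big_mkcond/=.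
apply: eq_bigr => i _; rewrite /G; case: eqVneq => [ni|ni].
  by rewrite /tterm !mulr0z !mul0r; ring.
rewrite /tterm mulr0 cos0 sin0.
have [c1 s1] := cexpi_2pi_int (n i).
by rewrite c1 s1; ring.
Qed.

End OneDim.

Lemma behead_cons_tuple d (k0 : int) (k : d.-tuple int) :
  behead_tuple (cons_tuple k0 k) = k.
Proof. exact: val_inj. Qed.

Lemma dotk_cons d (k : d.+1.-tuple int) (t : R) (x : d.-tuple R) :
  dotk R d.+1 k (cons_tuple t x) = (thead k)%:~R * t + dotk R d (behead_tuple k) x.
Proof.
case/tupleP: k => k0 k; have -> := behead_cons_tuple d k0 k.
rewrite /dotk big_ord_recl theadE !tnth0; congr (_ * _ + _).
by apply: eq_bigr => i _; rewrite !tnthS.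
Qed.

Lemma zerok_cons d (k : d.+1.-tuple int) :
  zerok k = (thead k == 0) && zerok (behead_tuple k).
Proof.
case/tupleP: k => k0 k; have -> := behead_cons_tuple d k0 k.
rewrite theadE; apply/forallP/andP => [k00|[k00 /forallP ks] i].
  by split; [exact: k00 ord0|apply/forallP => i; have := k00 (lift ord0 i); rewrite tnthS].
by have [j ->|->] := unliftP ord0 i; rewrite ?tnthS ?tnth0.
Qed.

(** The inner integral keeps the terms whose frequency has zero tail; the outer one then tests its
    first entry. *)
Lemma tint_trig d (T : Type) (r : seq T) (b : T -> C) (k : T -> d.-tuple int) :
  tint R d (fun x => (complex.Re (\sum_(t <- r) b t * e (dotk R d (k t) x)))%:E) =
  (complex.Re (\sum_(t <- r | zerok (k t)) b t))%:E.
Proof.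
elim: d r b k => [|d IH] r b k /=.
  congr (complex.Re _)%:E; rewrite [RHS]big_mkcond/=; apply: eq_bigr => t _.
  rewrite (_ : zerok _); last by apply/forallP => -[].
  by rewrite /dotk big_ord0 cexpi0 mulr1.
pose r' := [seq i <- r | zerok (behead_tuple (k i))].
under eq_integral => t _.
  rewrite (_ : (fun x : d.-tuple R => _) = (fun x => (complex.Re (\sum_(i <- r)
    (b i * e ((thead (k i))%:~R * t)) * e (dotk R d (behead_tuple (k i)) x)))%:E)).
    rewrite IH -big_filter -/r'; over.
  apply/funext => x; congr (complex.Re _)%:E; apply: eq_bigr => i _.
  by rewrite dotk_cons cexpiD mulrA.
rewrite integral_trig -EFinM mulrA mulVf ?mul1r; last first.
  by rewrite mulf_neq0// gt_eqF// pi_gt0.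
congr (complex.Re _)%:E; rewrite /r' big_filter_cond; apply: eq_bigl => i.
by rewrite zerok_cons andbC.
Qed.

(** The integral of a nonnegative function is a supremum over the simple functions below it, so
    monotonicity holds for arbitrary functions. This allows the error to be dominated by a
    trigonometric polynomial inside an iterated integral whose inner integrals need not be known to
    be measurable. *)
Lemma le_integral_nonneg (D : set R) (f g : R -> \bar R) :
  (forall t, D t -> (0 <= f t <= g t)%E) ->
  (0 <= \int[mu]_(t in D) f t <= \int[mu]_(t in D) g t)%E.
Proof.
move=> fg; have f0 t : D t -> (0 <= f t)%E by move=> /fg /andP[].
have g0 t : D t -> (0 <= g t)%E by move=> /fg /andP[]; exact: le_trans.
rewrite integral_ge0//= !ge0_integralE//.
apply: le_ereal_sup => _ [h hf <-]; exists h => // x; apply: le_trans (hf x) _.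
rewrite /patch; case: ifPn => // /set_mem /fg /andP[]//.
Qed.

Lemma le_tint d (f g : d.-tuple R -> \bar R) :
  (forall x, torus R d x -> (0 <= f x <= g x)%E) ->
  (0 <= tint R d f <= tint R d g)%E.
Proof.
elim: d f g => [|d IH] f g fg /=; first by apply: fg => -[].
have pi0 : (0 <= ((2 * pi)^-1)%:E :> \bar R)%E.
  by rewrite lee_fin invr_ge0 mulr_ge0// pi_ge0.
have /andP[h1 h2] : (0 <= \int[mu]_(t in I02pi R) tint R d (fun x => f (cons_tuple t x))
   <= \int[mu]_(t in I02pi R) tint R d (fun x => g (cons_tuple t x)))%E.
  apply: le_integral_nonneg => t; rewrite /I02pi/= in_itv/= => tpi.
  apply: IH => x xT; apply: fg => i.
  by have [j ->|->] := unliftP ord0 i; rewrite ?tnthS ?tnth0.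
by rewrite mule_ge0//= lee_pmul.
Qed.

End TrigPoly.

(** * Squared moduli of trigonometric polynomials and exact quadrature *)

Section TrigSquare.
Variable R : realType.
Local Notation C := R[i].
Local Notation e := (cexpi R).

Definition subk d (k l : d.-tuple int) : d.-tuple int :=
  [tuple tnth k i - tnth l i | i < d].

Lemma dotk_sub d (k l : d.-tuple int) x :
  dotk R d (subk d k l) x = dotk R d k x - dotk R d l x.
Proof.
rewrite /dotk -sumrB; apply: eq_bigr => i _.
by rewrite tnth_mktuple intrB mulrBl.
Qed.

Lemma sqn_conj (z : C) : sqn R z = complex.Re (z * z^*%C).
Proof. by case: z => x y; rewrite /sqn/=; ring. Qed.

Lemma sqn_trig d (T : Type) (r : seq T) (a : T -> C) (k : T -> d.-tuple int) x :
  sqn R (\sum_(t <- r) a t * e (dotk R d (k t) x)) =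
  complex.Re (\sum_(p <- [seq (t, t') | t <- r, t' <- r])
    (a p.1 * (a p.2)^*%C) * e (dotk R d (subk d (k p.1) (k p.2)) x)).
Proof.
rewrite sqn_conj; congr complex.Re; rewrite big_allpairs_dep/= mulr_suml.
apply: eq_bigr => t _; rewrite (rmorph_sum (@conjc R)) mulr_sumr.
apply: eq_bigr => t' _; rewrite [X in _ * X]rmorphM -[X in _ * (_ * X)]/(_^*%C).
rewrite conj_cexpi dotk_sub cexpiD.
by rewrite mulrACA.
Qed.

(* The grid of mesh [2 * pi / Q] integrates these polynomials exactly. *)
Definition trig_below d (Q : nat) (g : d.-tuple R -> R) : Prop :=
  exists (T : Type) (r : seq T) (b : T -> C) (k : T -> d.-tuple int),
    (forall t i, (`|tnth (k t) i| < Q)%N) /\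
    (forall x, g x = complex.Re (\sum_(t <- r) b t * e (dotk R d (k t) x))).

(** Both sides equal the real part of the sum of the coefficients at frequency zero. *)
Lemma trig_below_tint d Q g : (0 < Q)%N -> trig_below d Q g ->
  tint R d (fun x => (g x)%:E) =
  (#|{ffun 'I_d -> 'I_Q}|%:R^-1 * \sum_q g (gridpt R d Q q))%:E.
Proof.
move=> Q0 [T [r [b [k [kQ gE]]]]].
rewrite (_ : (fun x => _) =
  (fun x => (complex.Re (\sum_(t <- r) b t * e (dotk R d (k t) x)))%:E)); last first.
  by apply/funext => x; rewrite gE.
rewrite tint_trig [X in _ * X](eq_bigr _ (fun q _ => gE _)).
rewrite grid_quadrature// card_ffun !card_ord natrX mulrA mulVf ?mul1r//.
by rewrite expf_neq0// pnatr_eq0 -lt0n.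
Qed.

Lemma trig_below_cst d Q (c : R) : (0 < Q)%N -> trig_below d Q (fun=> c).
Proof.
move=> Q0; exists unit, [:: tt], (fun=> c%:C%C), (fun=> [tuple 0 | i < d]).
split=> [_ i|x]; first by rewrite tnth_mktuple.
rewrite big_seq1 /dotk big1 ?cexpi0 ?mulr1// => i _.
by rewrite tnth_mktuple mulr0z mul0r.
Qed.

Lemma trig_below_scale d Q (c : R) g :
  trig_below d Q g -> trig_below d Q (fun x => c * g x).
Proof.
move=> [T [r [b [k [kQ gE]]]]].
exists T, r, (fun t => c%:C%C * b t), k; split=> // x.
rewrite gE -(part_realM R true)/= mulr_sumr.
by congr complex.Re; apply: eq_bigr => t _; rewrite mulrA.
Qed.

Lemma trig_below_add d Q g h :
  trig_below d Q g -> trig_below d Q h -> trig_below d Q (fun x => g x + h x).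
Proof.
move=> [T [r [b [k [kQ gE]]]]] [T' [r' [b' [k' [kQ' hE]]]]].
exists (T + T')%type, ([seq inl t | t <- r] ++ [seq inr t | t <- r']),
  (fun t => match t with inl t => b t | inr t => b' t end),
  (fun t => match t with inl t => k t | inr t => k' t end).
split=> [[t|t] i|x]; [exact: kQ|exact: kQ'|].
by rewrite big_cat/= !big_map gE hE ReD.
Qed.

Lemma trig_below_sqn d Q h (T : Type) (r : seq T) (a : T -> C)
    (k : T -> d.-tuple int) :
  (forall t i, (`|tnth (k t) i| <= h)%N) -> (2 * h < Q)%N ->
  trig_below d Q (fun x => sqn R (\sum_(t <- r) a t * e (dotk R d (k t) x))).
Proof.
move=> kh hQ; exists (T * T)%type, [seq (t, t') | t <- r, t' <- r],
  (fun p => a p.1 * (a p.2)^*%C), (fun p => subk d (k p.1) (k p.2)).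
split=> [[t t'] i /=|x]; last exact: sqn_trig.
rewrite tnth_mktuple; apply: leq_ltn_trans hQ.
have := kh t i; have := kh t' i; lia.
Qed.

Lemma grid_parseval d Q h (I : finType) (k : I -> d.-tuple int) (c : I -> C) :
  injective k -> (forall t i, (`|tnth (k t) i| <= h)%N) -> (2 * h < Q)%N ->
  \sum_q sqn R (\sum_i c i * e (dotk R d (k i) (gridpt R d Q q))) =
  #|{ffun 'I_d -> 'I_Q}|%:R * \sum_i sqn R (c i).
Proof.
move=> kI kh hQ.
under eq_bigr do rewrite sqn_trig.
rewrite grid_quadrature; last first.
  move=> [t t'] i /=; rewrite tnth_mktuple; apply: leq_ltn_trans hQ.
  by have := kh t i; have := kh t' i; lia.
rewrite card_ffun !card_ord natrX; congr (_ * _).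
rewrite big_mkcond big_allpairs_dep/= Re_sum; apply: eq_bigr => i _.
rewrite (bigD1 i)//= big1 ?addr0 => [|j ji].
  rewrite (_ : zerok _) ?sqn_conj//; apply/forallP => l.
  by rewrite tnth_mktuple subrr.
case: ifP => // /forallP z; case/eqP: ji; apply: kI; apply: eq_from_tnth => l.
by have := z l; rewrite tnth_mktuple subr_eq0 => /eqP.
Qed.

End TrigSquare.

(** * Lists of frequencies and their coefficients *)

Section FrequencySets.
Variable R : realType.
Local Notation C := R[i].
Local Notation e := (cexpi R).

(** Maurey's method draws with replacement, so frequencies may repeat in [r]; equal ones are merged,
    and elements of [S] missing from [r] get coefficient [0]. *)
Lemma tpoly_collect d (r : seq (C * d.-tuple int)) (S : seq (d.-tuple int)) x :
  uniq S -> {subset [seq t.2 | t <- r] <= S} ->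
  \sum_(t <- r) t.1 * e (dotk R d t.2 x) =
  tpoly R d S (fun k => \sum_(t <- r | t.2 == k) t.1) x.
Proof.
move=> uS; rewrite /tpoly; elim: r => [|t r IH] rS.
  by rewrite big_nil big1// => k _; rewrite big_nil mul0r.
rewrite big_cons IH; last by move=> k kr; apply: rS; rewrite inE kr orbT.
rewrite [RHS](eq_bigr (fun k => (if t.2 == k then t.1 * e (dotk R d k x) else 0) +
    (\sum_(t <- r | t.2 == k) t.1) * e (dotk R d k x))); last first.
  by move=> k _; rewrite big_cons; case: ifP => _; rewrite ?mulrDl ?add0r.
rewrite big_split/=; congr (_ + _).
have tS : t.2 \in S by apply: rS; rewrite inE eqxx.
by rewrite (bigD1_seq t.2)//= eqxx big1 ?addr0// => k; rewrite eq_sym => /negbTE ->.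
Qed.

(** [vsubsets] asks for exactly [v] frequencies, so a shorter list is padded with other elements of
    [G]. *)
Lemma extend_freqs (K : eqType) (fr G : seq K) (v : nat) :
  uniq G -> {subset fr <= G} -> (size fr <= v)%N -> (v <= size G)%N ->
  exists S : seq K, [/\ uniq S, size S = v, {subset S <= G} & {subset fr <= S}].
Proof.
move=> uG frG frv vG.
set U := undup fr; set W := [seq k <- G | k \notin U].
have sU : (size U <= v)%N by apply: leq_trans frv; exact: size_undup.
have sW : (size U + size W = size G)%N.
  rewrite -size_cat; apply/perm_size/uniq_perm => //.
    rewrite cat_uniq undup_uniq filter_uniq//= andbT.
    by apply/hasPn => k; rewrite mem_filter => /andP[].
  move=> k; rewrite mem_cat mem_filter /U mem_undup.
  by case: (boolP (k \in fr)) => [/frG ->|].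
exists (U ++ take (v - size U) W); split.
- rewrite cat_uniq undup_uniq/= take_uniq ?filter_uniq// andbT.
  by apply/hasPn => k /mem_take; rewrite mem_filter => /andP[].
- rewrite size_cat size_takel ?subnKC//.
  by rewrite leq_subLR sW.
- move=> k; rewrite mem_cat => /orP[| /mem_take]; first by rewrite mem_undup => /frG.
  by rewrite mem_filter => /andP[].
- by move=> k kf; rewrite mem_cat mem_undup kf.
Qed.

Section Reindex.
Variables (I : finType) (K : eqType) (k : I -> K) (S : seq K).
Hypotheses (kI : injective k) (uS : uniq S) (Sk : {subset S <= codom k}).

Lemma perm_reindex : perm_eq S [seq k i | i <- enum I & k i \in S].
Proof.
apply: uniq_perm => //; first by rewrite map_inj_uniq// filter_uniq// enum_uniq.
move=> x; apply/idP/mapP => [xS|[j]]; last by rewrite mem_filter => /andP[? _] ->.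
by have /codomP[i xi] := Sk x xS; exists i; rewrite // mem_filter -xi xS mem_enum.
Qed.

Lemma sum_reindex (V : nmodType) (F : K -> V) :
  \sum_(x <- S) F x = \sum_(i | k i \in S) F (k i).
Proof.
by rewrite (perm_big _ perm_reindex) big_map big_filter big_enum_cond.
Qed.

Lemma card_reindex : #|[pred i | k i \in S]| = size S.
Proof.
rewrite (perm_size perm_reindex) size_map -sum1_size big_filter big_enum_cond/=.
by rewrite sum1_card.
Qed.

End Reindex.

End FrequencySets.

(** * Dyadic layers and the hyperbolic cross *)

Section Layers.

Lemma shiftE d j (t : d.-tuple 'I_(2 ^ j.+1)) i :
  tnth (Defs.shift d j t) i = (tnth t i : nat)%:Z - (2 ^ j)%:Z.
Proof. by rewrite tnth_mktuple. Qed.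

Lemma shift_inj d j : injective (Defs.shift d j).
Proof.
move=> t t' tt'; apply: eq_from_tnth => i; apply: val_inj => /=.
have : tnth (Defs.shift d j t) i = tnth (Defs.shift d j t') i by rewrite tt'.
by rewrite !shiftE => /addIr [].
Qed.

Lemma shift_le d j (t : d.-tuple 'I_(2 ^ j.+1)) i :
  (`|tnth (Defs.shift d j t) i| <= 2 ^ j)%N.
Proof.
rewrite shiftE; have : (tnth t i < 2 * 2 ^ j)%N by rewrite -expnS.
by move: (tnth t i : nat) (2 ^ j)%N => n m; lia.
Qed.

Lemma shift_onto d j (k : d.-tuple int) :
  (forall i, (`|tnth k i| < 2 ^ j)%N) -> k \in codom (Defs.shift d j).
Proof.
move=> kj.
have P i : (absz (tnth k i + (2 ^ j)%:Z)%R < 2 ^ j.+1)%N.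
  by have := kj i; rewrite expnS; move: (2 ^ j)%N => m; lia.
apply/codomP; exists [tuple Ordinal (P i) | i < d].
apply: eq_from_tnth => i; rewrite shiftE tnth_mktuple/=.
by have := kj i; move: (2 ^ j)%N => m; lia.
Qed.

Lemma card_le_inj (T U : finType) (A : pred T) (B : pred U) (f : T -> U) :
  {in A &, injective f} -> (forall x, x \in A -> f x \in B) -> (#|A| <= #|B|)%N.
Proof.
move=> fI fB; rewrite -(card_in_imset fI); apply: subset_leq_card.
by apply/fintype.subsetP => _ /imsetP[x xA ->]; exact: fB.
Qed.

Lemma card_ord_interval (n a b : nat) : (#|[pred u : 'I_n | a <= u < a + b]| <= b)%N.
Proof.
rewrite cardE -(size_map val) -[leqRHS](size_iota a b).
apply: uniq_leq_size => [|_ /mapP[u + ->]].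
  by rewrite map_inj_uniq ?enum_uniq//; exact: val_inj.
by rewrite mem_enum mem_iota inE.
Qed.

(** The first entry is determined by the others. The exponent, one less than the dimension, is the
    origin of the [d - 1] multiplying [a] in the rate. *)
Lemma card_sum_tuples d j :
  (#|[pred s : d.+1.-tuple 'I_j.+1 | \sum_(i < d.+1) (tnth s i : nat) == j]| <=
   j.+1 ^ d)%N.
Proof.
rewrite -[in leqRHS](card_ord j.+1) -card_tuple.
apply: (card_le_inj _ _ _ _ (fun s : d.+1.-tuple 'I_j.+1 => behead_tuple s)) => // s s'.
case/tupleP: s => s0 s; case/tupleP: s' => s0' s'.
rewrite !inE !big_ord_recl !tnth0 => /eqP h /eqP h' /(congr1 val)/= ss'.
have {}ss' : s = s' by exact: val_inj.
subst s'; congr [tuple of _ :: _]; apply: val_inj => /=.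
have e : (s0 + \sum_(i < d) tnth s i = s0' + \sum_(i < d) tnth s i)%N.
  rewrite (eq_bigr (fun i => tnth s i : nat)) in h => [|i _]; last by rewrite tnthS.
  rewrite (eq_bigr (fun i => tnth s i : nat)) in h' => [|i _]; last by rewrite tnthS.
  by rewrite h h'.
exact: addIn e.
Qed.

Lemma card_rho d j (s : d.-tuple nat) :
  (#|[pred t : d.-tuple 'I_(2 ^ j.+1) | inrho d s (Defs.shift d j t)]| <=
   2 ^ (d + \sum_(i < d) tnth s i))%N.
Proof.
pose F (i : 'I_d) : pred 'I_(2 ^ j.+1) :=
  [pred u : 'I_(2 ^ j.+1) | (2 ^ j - (2 ^ tnth s i).-1 <= u <
             2 ^ j - (2 ^ tnth s i).-1 + 2 ^ (tnth s i).+1)%N].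
apply: (@leq_trans #|family F|).
  apply: (card_le_inj _ _ _ _ (fun t => [ffun i => tnth t i])).
    move=> t t' _ _ /ffunP tt'; apply: eq_from_tnth => i.
    by have := tt' i; rewrite !ffunE.
  move=> t; rewrite inE => /forallP ts; apply/familyP => i.
  have /andP[_] := ts i; rewrite ffunE shiftE inE (expnS 2 (tnth s i)).
  by move: (tnth t i : nat) (2 ^ j)%N (2 ^ tnth s i)%N => n m p; lia.
rewrite card_family foldrE big_map big_enum/= expnD.
rewrite -[X in (2 ^ X * _)%N](card_ord d) -prod_nat_const expn_sum -big_split/=.
apply: leq_prod => i _; rewrite -expnS; exact: card_ord_interval.
Qed.

Definition in_layer d j (q : d.-tuple 'I_j.+1 * d.-tuple 'I_(2 ^ j.+1)) : bool :=
  (\sum_(i < d) (tnth q.1 i : nat) == j)%N &&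
  inrho d [tuple (tnth q.1 i : nat) | i < d] (Defs.shift d j q.2).

Definition layer_seq d j : seq (d.-tuple int) :=
  [seq Defs.shift d j q.2 |
     q <- enum {: d.-tuple 'I_j.+1 * d.-tuple 'I_(2 ^ j.+1)} & in_layer d j q].

Lemma layer_sumE (V : nmodType) d j (F : d.-tuple int -> V) :
  layer_sum V d j F = \sum_(k <- layer_seq d j) F k.
Proof.
rewrite /layer_sum /layer_seq big_map big_filter big_enum_cond/=.
by rewrite (pair_big_dep _ _ (fun _ t => F (Defs.shift d j t))).
Qed.

Lemma size_layer_seq d j : (size (layer_seq d.+1 j) <= 2 ^ (d.+1 + j) * j.+1 ^ d)%N.
Proof.
rewrite /layer_seq size_map -sum1_size big_filter big_enum_cond/=.
rewrite -(pair_big_dep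
  (fun s : d.+1.-tuple 'I_j.+1 => \sum_(i < d.+1) (tnth s i : nat) == j)%N
  (fun s t => inrho d.+1 [tuple (tnth s i : nat) | i < d.+1] (Defs.shift d.+1 j t))
  (fun _ _ => 1%N))/=.
apply: (@leq_trans (\sum_(s : d.+1.-tuple 'I_j.+1 |
    (\sum_(i < d.+1) (tnth s i : nat) == j)%N) 2 ^ (d.+1 + j))%N).
  apply: leq_sum => s /eqP sj; rewrite sum1_card.
  have := card_rho d.+1 j [tuple (tnth s i : nat) | i < d.+1].
  by rewrite [X in (_ + X)%N](_ : _ = j)// -[RHS]sj; apply: eq_bigr => i _;
    rewrite tnth_mktuple.
by rewrite sum_nat_const mulnC leq_mul2l card_sum_tuples orbT.
Qed.

Definition gprod d (k : d.-tuple int) : nat := (\prod_(i < d) maxn `|tnth k i| 1)%N.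

Lemma layer_seq_gprod d j k : k \in layer_seq d j -> (gprod d k <= 2 ^ j)%N.
Proof.
move=> /mapP[[s t]]; rewrite mem_filter/= => /andP[/andP[/eqP sj /forallP st] _] ->.
apply: (@leq_trans (2 ^ \sum_(i < d) (tnth s i : nat))%N); last by rewrite sj.
rewrite expn_sum; apply: leq_prod => i _.
have /andP[_] := st i; rewrite tnth_mktuple => h.
by rewrite geq_max (ltnW h)/= expn_gt0.
Qed.

Lemma le_gprod d (k : d.-tuple int) i : (`|tnth k i| <= gprod d k)%N.
Proof.
rewrite /gprod (bigD1 i)//= -[leqLHS]muln1 leq_mul ?leq_maxl//.
by apply: prodn_cond_gt0 => j _; rewrite leq_max orbT.
Qed.

(** [Gamma(2^J)] as a list. It lies in the enumerated box because
    [|k_i| <= gprod k <= 2^J < 2^(J+1)]; the same box later indexes the exponentials. *)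
Definition hyperbolic_cross d J : seq (d.-tuple int) :=
  [seq Defs.shift d J.+1 t | t <- enum {: d.-tuple 'I_(2 ^ J.+2)} &
     (gprod d (Defs.shift d J.+1 t) <= 2 ^ J)%N].

Lemma hyperbolic_cross_uniq d J : uniq (hyperbolic_cross d J).
Proof. by rewrite (map_inj_uniq (shift_inj d J.+1)) filter_uniq// enum_uniq. Qed.

Lemma mem_hyperbolic_cross d J k :
  (k \in hyperbolic_cross d J) = (gprod d k <= 2 ^ J)%N.
Proof.
apply/mapP/idP => [[t]|kJ]; first by rewrite mem_filter => /andP[? _] ->.
have /codomP[t kt] : k \in codom (Defs.shift d J.+1).
  apply: shift_onto => i; apply: leq_ltn_trans (le_gprod d k i) _.
  by apply: leq_ltn_trans kJ _; rewrite ltn_exp2l.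
by exists t => //; rewrite mem_filter -kt kJ mem_enum.
Qed.

Lemma size_hyperbolic_cross d J : (size (hyperbolic_cross d J) <= 2 ^ (J.+2 * d))%N.
Proof.
rewrite size_map size_filter (leq_trans (count_size _ _))//.
by rewrite -cardT card_tuple card_ord expnM.
Qed.

(** The frequencies [(u, 0, ..., 0)] with [u < v] all lie in the cross. *)
Lemma size_hyperbolic_cross_ge d J v :
  (v <= 2 ^ J)%N -> (v <= size (hyperbolic_cross d.+1 J))%N.
Proof.
move=> vJ.
pose kk (u : nat) : d.+1.-tuple int := [tuple if i == ord0 then u%:Z else 0 | i < d.+1].
rewrite -[leqLHS](size_iota 0 v) -(size_map kk).
apply: uniq_leq_size.
  rewrite map_inj_uniq ?iota_uniq// => u u' /(congr1 (fun k => tnth k ord0)).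
  by rewrite !tnth_mktuple eqxx => -[].
move=> _ /mapP[u + ->]; rewrite mem_iota/= add0n => uv.
rewrite mem_hyperbolic_cross /gprod big_ord_recl big1 ?muln1.
  by rewrite tnth_mktuple eqxx geq_max expn_gt0 andbT (leq_trans (ltnW uv)).
by move=> i _; rewrite tnth_mktuple.
Qed.

Lemma inGammaE (R : realType) d J (k : d.-tuple int) :
  inGamma R d (2 ^ J)%:R k <-> k \in hyperbolic_cross d J.
Proof. by rewrite mem_hyperbolic_cross /inGamma -natr_prod ler_nat. Qed.

End Layers.

(** * Choice of the parameters *)

Section Calculus.
Variable R : realType.

Lemma powR_expR (x b : R) : 0 < x -> x `^ b = expR (b * ln x).
Proof. by move=> x0; rewrite /powR gt_eqF. Qed.

Lemma ln_le_linear (eps x : R) : 0 < eps -> 0 < x -> ln x <= eps * x - 1 - ln eps.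
Proof.
move=> e0 x0; have := expR_ge1Dx (ln (eps * x)).
by rewrite lnK ?posrE ?mulr_gt0// lnM ?posrE//; lra.
Qed.

Lemma ln2_le1 : ln 2 <= 1 :> R.
Proof. by have := expR_ge1Dx (ln 2 : R); rewrite lnK ?posrE//; lra. Qed.

(** The sign of [B] decides which end of the range is extremal; adding both constants covers the two
    cases. *)
Lemma powR_comparable (c1 c2 B x y : R) : 0 < c1 -> 0 < y ->
  c1 * y <= x <= c2 * y -> x `^ B <= (c1 `^ B + c2 `^ B) * y `^ B.
Proof.
move=> c10 y0 /andP[h1 h2].
have x0 : 0 < x by apply: lt_le_trans h1; rewrite mulr_gt0.
have c20 : 0 < c2 by rewrite -(pmulr_lgt0 _ y0) (lt_le_trans x0).
have P c : 0 < c -> c `^ B * y `^ B = expR (B * ln (c * y)).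
  by move=> c0; rewrite -powRM ?ltW// powR_expR// mulr_gt0.
rewrite mulrDl !P// powR_expR//.
have lx1 : ln (c1 * y) <= ln x by rewrite ler_ln ?posrE ?mulr_gt0.
have lx2 : ln x <= ln (c2 * y) by rewrite ler_ln ?posrE ?mulr_gt0.
have [B0|B0] := leP 0 B.
  apply: (@le_trans _ _ (expR (B * ln (c2 * y)))); last by rewrite lerDr expR_ge0.
  by rewrite ler_expR ler_wpM2l.
apply: (@le_trans _ _ (expR (B * ln (c1 * y)))); last by rewrite lerDl expR_ge0.
by rewrite ler_expR ler_wnM2l// ltW.
Qed.

Lemma powR_expo_bound (be de : R) : 0 <= be -> 0 < de ->
  exists2 K : R, 0 < K & forall r : nat, r.+1%:R `^ be <= K * expR (de * r%:R).
Proof.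
move=> be0 de0; pose eps := de / (be + 1).
have b10 : 0 < be + 1 by lra.
have e0 : 0 < eps by rewrite divr_gt0.
exists (expR (de + be * (- 1 - ln eps))); first exact: expR_gt0.
move=> r; rewrite powR_expR// -expRD ler_expR.
have h := ln_le_linear eps r.+1%:R e0 (ltr0Sn _ _).
have h2 : be * ln r.+1%:R <= be * (eps * r.+1%:R - 1 - ln eps) by rewrite ler_wpM2l.
have h3 : be * eps <= de by rewrite /eps mulrA ler_pdivrMr// mulrC; nra.
have h4 : be * eps * r.+1%:R <= de * r.+1%:R by rewrite ler_wpM2r.
by move: h2 h4; rewrite -(natr1 r); lra.
Qed.

Lemma geometric_sum_le (rho : R) (n : nat) : 0 <= rho < 1 ->
  \sum_(r < n) rho ^+ r <= (1 - rho)^-1.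
Proof.
move=> /andP[r0 r1]; have h : 0 < 1 - rho by lra.
rewrite -[leRHS]div1r ler_pdivlMr// mulrC.
have -> : (1 - rho) * \sum_(r < n) rho ^+ r = 1 - rho ^+ n.
  by rewrite -[RHS]opprB subrX1 -mulNr opprB.
by rewrite gerBl exprn_ge0.
Qed.

Definition layer_bound (a B : R) (j : nat) : R :=
  2 `^ (- a * j%:R) * (maxn j 1)%:R `^ B.

Lemma layer_bound_ge0 a B j : 0 <= layer_bound a B j.
Proof. by rewrite mulr_ge0 ?powR_ge0. Qed.

(** For [B >= 0] this rests on [max (n + r) 1 <= max n 1 * (r + 1)]; for [B <= 0] the power does not
    increase with the index and the correction is [1]. *)
Lemma layer_bound_shift (a B : R) (n r : nat) :
  layer_bound a B (n + r) <=
  layer_bound a B n * (expR (- (a * ln 2 * r%:R)) * r.+1%:R `^ (Num.max B 0)).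
Proof.
rewrite /layer_bound natrD mulrDr !powR_expR// mulrDl expRD -!mulrA.
rewrite ler_wpM2l ?expR_ge0//.
have -> : - a * (r%:R * ln 2) = - (a * (ln 2 * r%:R)) by ring.
rewrite [leRHS]mulrCA ler_wpM2l ?expR_ge0//.
rewrite -!powR_expR// ?ltr0n ?leq_max ?orbT//.
have /orP[B0|B0] := le_total 0 B.
  rewrite max_l// -powRM//; apply: ge0_ler_powR => //; rewrite ?nnegrE ?mulr_ge0//.
  rewrite -natrM ler_nat geq_max; apply/andP; split; last by rewrite muln_gt0 leq_max orbT.
  by have := leq_maxl n 1; have := leq_maxr n 1; nia.
rewrite max_r// powRr0 mulr1 !powR_expR ?ltr0n ?leq_max ?orbT//.
rewrite ler_expR ler_wnM2l // ler_ln ?posrE ?ltr0n ?leq_max ?orbT//.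
by rewrite ler_nat geq_max !leq_max leq_addr orbT.
Qed.

(** Half of the exponential decay absorbs the polynomial factor, leaving a geometric series of ratio
    [2^(-a/2)]. The same [K] will bound the [A]-norm of the middle layers and the remainder beyond
    [J]. *)
Lemma layer_tail (a B : R) : 0 < a -> exists2 K : R, 0 < K &
  forall n J : nat, \sum_(n <= j < J) layer_bound a B j <= K * layer_bound a B n.
Proof.
move=> a0; have l2 := ln2_ge R.
have al0 : 0 < a * ln 2 by rewrite mulr_gt0//; lra.
have B0 : 0 <= Num.max B 0 by rewrite le_max lexx orbT.
have de0 : 0 < a * ln 2 / 2 by rewrite divr_gt0.
have [K K0 KP] := powR_expo_bound (Num.max B 0) (a * ln 2 / 2) B0 de0.
pose rho := expR (- (a * ln 2 / 2)).
have rho1 : 0 <= rho < 1 by rewrite expR_ge0/= -expR0 ltr_expR; lra.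
have r10 : 0 < 1 - rho by lra.
exists (K / (1 - rho)) => [|n J]; first by rewrite divr_gt0.
rewrite -{1}(add0n n) big_addn big_mkord.
apply: (@le_trans _ _ (\sum_(r < J - n) layer_bound a B n * K * rho ^+ r)).
  apply: ler_sum => r _; rewrite addnC; apply: le_trans (layer_bound_shift _ _ _ _) _.
  rewrite -[leRHS]mulrA ler_wpM2l ?layer_bound_ge0//.
  have -> : K * rho ^+ r = expR (- (a * ln 2 * r%:R)) * (K * expR (a * ln 2 / 2 * r%:R)).
    rewrite mulrCA -expRD /rho -expRM_natl; congr (_ * expR _); lra.
  by rewrite ler_wpM2l ?expR_ge0.
rewrite -mulr_sumr mulrC [leRHS]mulrAC mulrC [K * _]mulrC.
by rewrite ler_wpM2l ?geometric_sum_le// mulr_ge0 ?layer_bound_ge0// ltW.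
Qed.

(* [n] is the largest integer with [2 ^ (D.+2 + n) * n ^ D <= v], or [0]. *)
Lemma full_layers (D : nat) : exists c c1 : R, [/\ 0 < c, 0 < c1 &
  forall v : nat, (2 <= v)%N -> exists n : nat,
  [/\ n = 0%N \/ (2 ^ (D.+2 + n) * n ^ D <= v)%N,
      (2 ^ n)%:R^-1 <= c * v%:R^-1 * ln v%:R ^+ D :> R,
      c1 * ln v%:R <= (maxn n 1)%:R <= (4 : R) * ln v%:R &
      (2 ^ n <= v)%N]].
Proof.
(* Maximality of [n] gives [v < 2^(D + 3 + n) (n + 1)^D], and [n + 1 <= 4 ln v]. *)
pose c : R := 2 ^+ (D + 3) * 4 ^+ D.
have c0 : 0 < c by rewrite mulr_gt0 ?exprn_gt0.
(* Taking logarithms in the bound on [2^-n] gives [y <= ln c + D ln y + n] for [y = ln v]; the term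
   [D ln y] is at most [y / 2] plus a constant. *)
pose c2 : R := 2 + `|ln c| + D%:R * `|ln (2 * D.+1%:R)|.
have c20 : 2 <= c2.
  by rewrite /c2 -addrA lerDl addr_ge0 ?mulr_ge0.
exists c, (2 * c2)^-1; split => // [|v v2]; first by rewrite invr_gt0; lra.
have v0 : (0 < v)%N by apply: leq_trans v2.
have vR0 : 0 < v%:R :> R by rewrite ltr0n.
set y : R := ln v%:R.
have l2 := ln2_ge R; have l21 := ln2_le1.
have y2 : ln 2 <= y by rewrite ler_ln ?posrE// ler_nat.
have y0 : 0 < y by lra.
pose P n := (n == 0)%N || (2 ^ (D.+2 + n) * n ^ D <= v)%N.
have P2 n : P n -> (2 ^ n <= v)%N.
  move=> /predU1P[->|]; first by rewrite expn0.
  case: n => [|n]; first by rewrite expn0.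
  apply: leq_trans; rewrite -[leqLHS]muln1 leq_mul ?expn_gt0// leq_exp2l//.
  by rewrite leq_addl.
have Pv n : P n -> (n <= v)%N by move=> /P2 /(leq_trans _); apply; exact/ltnW/ltn_expl.
have exP : exists n, P n by exists 0%N.
have [n Pn nmax] := ex_maxnP exP Pv.
exists n.
have h2n := P2 n Pn.
have n_le : n.+1%:R <= 4 * y.
  have : n%:R * ln 2 <= y.
    rewrite -ler_expR expRM_natl !lnK ?posrE// -natrX ler_nat//.
  by rewrite -(natr1 n); have : 0 <= n%:R :> R by []; nra.
have nn : (2 ^ n)%:R^-1 <= c * v%:R^-1 * y ^+ D.
  have : (v < 2 ^ (D.+2 + n.+1) * n.+1 ^ D)%N.
    by rewrite ltnNge; apply/negP => h; have := nmax n.+1; rewrite /P h orbT ltnn => /(_ isT).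
  rewrite -(ltr_nat R) natrM !natrX => /ltW h.
  rewrite mulrAC ler_pdivlMr// mulrC ler_pdivrMr ?exprn_gt0//.
  apply: le_trans h _.
  have -> : c * y ^+ D * 2 ^+ n = 2 ^+ (D.+2 + n.+1) * (4 * y) ^+ D.
    by rewrite /c exprMn !exprD !exprS; ring.
  by rewrite ler_pM2l ?exprn_gt0// lerXn2r// ?nnegrE// mulr_ge0// ltW.
split=> //; first by move: Pn => /predU1P[->|]; [left|right].
apply/andP; split; last first.
  by apply: le_trans n_le; rewrite ler_nat geq_max ltnW.
have m1 : 1 <= (maxn n 1)%:R :> R by rewrite ler1n leq_max orbT.
have mn : n%:R <= (maxn n 1)%:R :> R by rewrite ler_nat leq_maxl.
rewrite ler_pdivrMl; last by lra.
have hln : y <= ln c + D%:R * ln y + n%:R.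
  have h : v%:R <= expR (ln c + D%:R * ln y + n%:R * ln 2).
    rewrite !expRD !expRM_natl !lnK ?posrE//.
    by move: nn; rewrite natrX mulrAC ler_pdivlMr// mulrC ler_pdivrMr ?exprn_gt0.
  have : y <= ln c + D%:R * ln y + n%:R * ln 2.
    by rewrite -ler_expR /y lnK ?posrE.
  have : n%:R * ln 2 <= n%:R * 1 :> R by rewrite ler_wpM2l.
  lra.
have D10 : 0 < D.+1%:R :> R by [].
have hy : D%:R * ln y <= y / 2 + D%:R * `|ln (2 * D.+1%:R)|.
  have e0 : 0 < (2 * D.+1%:R)^-1 :> R by rewrite invr_gt0 mulr_gt0.
  have h := ln_le_linear _ y e0 y0; rewrite lnV ?posrE ?mulr_gt0// in h.
  have h1 := ler_norm (ln (2 * D.+1%:R : R)).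
  have h2 : ln y <= (2 * D.+1%:R)^-1 * y + `|ln (2 * D.+1%:R)|.
    by move: h h1; move: (ln (2 * _)) ((2 * _)^-1) => lg ep; lra.
  have h3 : D%:R * ln y <= D%:R * ((2 * D.+1%:R)^-1 * y + `|ln (2 * D.+1%:R)|).
    by rewrite ler_wpM2l.
  apply: le_trans h3 _; rewrite mulrDr lerD2r mulrA [leRHS]mulrC ler_wpM2r ?(ltW y0)//.
  rewrite ler_pdivrMr ?mulr_gt0// -(natr1 D); lra.
have := ler_norm (ln c); have nD : 0 <= D%:R * `|ln (2 * D.+1%:R)| :> R by rewrite mulr_ge0.
have nc := normr_ge0 (ln c); rewrite /c2; nra.
Qed.

(** [J] is the first integer above [ka log_2 v]. Its lower bound makes the remainder small; its
    upper bound keeps the cross of size polynomial in [v]. *)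
Lemma cutoff_layer (ka : R) (v : nat) : 1 <= ka -> (2 <= v)%N ->
  exists J : nat, [/\ v%:R `^ ka <= (2 ^ J)%:R, (v <= 2 ^ J)%N,
    (ln v%:R : R) <= J%:R <= (2 * ka + 2) * ln v%:R &
    J%:R * ln 2 <= ka * ln v%:R + ln 2 :> R].
Proof.
move=> ka1 v2.
have v0 : (0 < v)%N by apply: leq_trans v2.
have vR0 : 0 < v%:R :> R by rewrite ltr0n.
set y : R := ln v%:R.
have l2 := ln2_ge R; have l21 := ln2_le1.
have y2 : ln 2 <= y by rewrite ler_ln ?posrE// ler_nat.
have l20 : 0 < ln 2 :> R by lra.
have q0 : 0 <= ka * y / ln 2 by rewrite divr_ge0 ?mulr_ge0//; lra.
pose J := (Num.truncn (ka * y / ln 2)).+1.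
have J1 : ka * y <= J%:R * ln 2 by rewrite -ler_pdivrMr//; exact/ltW/truncnS_gt.
have J2 : J%:R * ln 2 <= ka * y + ln 2.
  rewrite /J -(natr1 (Num.truncn _)) mulrDl mul1r lerD2r -ler_pdivlMr//.
  by rewrite truncn_le.
have vJ : v%:R `^ ka <= (2 ^ J)%:R.
  rewrite powR_expR// natrX -[X in _ <= X ^+ _](lnK _) ?posrE//.
  by rewrite -expRM_natl ler_expR.
exists J; split => //.
- rewrite -(ler_nat R); apply: le_trans vJ; rewrite powR_expR//.
  by rewrite -[leLHS]lnK ?posrE// ler_expR -/y ler_peMl//; lra.
- have h1 : J%:R * ln 2 <= J%:R :> R by rewrite ler_piMr.
  have h2 : y <= ka * y by rewrite ler_peMl// (le_trans _ y2)// ltW.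
  have h3 : (J%:R - 1) * 2^-1 <= (J%:R - 1) * ln 2 :> R.
    by rewrite ler_wpM2l// subr_ge0 ler1n.
  have yl := le_trans l2 y2.
  by clear q0 vJ; apply/andP; split; lra.
Qed.

End Calculus.

(** * Comparison of the layer bounds with the claimed rate *)

Section Rates.
Variable R : realType.

(** [D] stands for [d - 1]. The remaining factor [(ln v)^(1/2)] of the claim comes from the sampling
    inequality. *)
Definition rate (a b : R) (D v : nat) : R :=
  v%:R `^ (- a - 2^-1) * ln v%:R `^ (D%:R * (a + b)).

Lemma ln_nat_ge (v : nat) : (2 <= v)%N -> 2^-1 <= ln v%:R :> R.
Proof.
move=> v2; apply: le_trans (ln2_ge R) _.
by rewrite ler_ln ?posrE ?ltr0n ?ler_nat// (leq_trans _ v2).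
Qed.

(** The bound on [2^-n] yields [v^-a (ln v)^(D a)], and [n] of order [ln v] yields [(ln v)^(D b)];
    the division by [v] is Maurey's gain, a factor [v^(-1/2)] before squaring. *)
Lemma low_rate (a b c c1 : R) (D : nat) : 0 < a -> 0 < c -> 0 < c1 ->
  exists C : R, forall v n : nat, (2 <= v)%N ->
  (2 ^ n)%:R^-1 <= c * v%:R^-1 * ln v%:R ^+ D :> R ->
  c1 * ln v%:R <= (maxn n 1)%:R <= (4 : R) * ln v%:R ->
  layer_bound R a (D%:R * b) n ^+ 2 / v%:R <= C * rate a b D v ^+ 2.
Proof.
move=> a0 c0 c10; pose c3 := c1 `^ (D%:R * b) + 4 `^ (D%:R * b).
exists ((c `^ a * c3) ^+ 2) => v n v2 hn hn1.
have v0 : 0 < v%:R :> R by rewrite ltr0n (leq_trans _ v2).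
have y2 := ln_nat_ge v v2.
have y0 : 0 < ln v%:R :> R by lra.
have h1 : 2 `^ (- a * n%:R) <= c `^ a * (v%:R `^ (- a) * ln v%:R `^ (D%:R * a)).
  have -> : 2 `^ (- a * n%:R) = (2 ^ n)%:R^-1 `^ a :> R.
    rewrite !powR_expR ?invr_gt0 ?ltr0n ?expn_gt0//; congr expR.
    by rewrite natrX lnV ?posrE ?exprn_gt0// lnXn// -mulr_natl; ring.
  apply: le_trans (ge0_ler_powR (ltW a0) _ _ hn) _; rewrite ?nnegrE ?invr_ge0//.
    by rewrite !mulr_ge0 ?invr_ge0 ?exprn_ge0// ltW.
  rewrite !powR_expR ?mulr_gt0 ?invr_gt0 ?exprn_gt0// -!expRD ler_expR.
  rewrite !lnM ?posrE ?mulr_gt0 ?invr_gt0 ?exprn_gt0// lnV ?posrE// lnXn// -mulr_natl.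
  by rewrite le_eqVlt; apply/orP; left; apply/eqP; ring.
have h2 : (maxn n 1)%:R `^ (D%:R * b) <= c3 * ln v%:R `^ (D%:R * b).
  exact: powR_comparable.
have h3 : layer_bound R a (D%:R * b) n <=
    c `^ a * (v%:R `^ (- a) * ln v%:R `^ (D%:R * a)) * (c3 * ln v%:R `^ (D%:R * b)).
  by rewrite /layer_bound ler_pM ?powR_ge0.
have h4 : c `^ a * (v%:R `^ (- a) * ln v%:R `^ (D%:R * a)) * (c3 * ln v%:R `^ (D%:R * b))
    = c `^ a * c3 * (rate a b D v * v%:R `^ 2^-1).
  have -> : rate a b D v * v%:R `^ 2^-1 =
      v%:R `^ (- a) * (ln v%:R `^ (D%:R * a) * ln v%:R `^ (D%:R * b)).
    rewrite /rate !powR_expR// -!expRD; congr expR; ring.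
  by ring.
rewrite ler_pdivrMr//.
have -> : (c `^ a * c3) ^+ 2 * rate a b D v ^+ 2 * v%:R =
    (c `^ a * c3 * (rate a b D v * v%:R `^ 2^-1)) ^+ 2.
  have vv : v%:R = (v%:R `^ 2^-1) ^+ 2 :> R.
    by rewrite expr2 powR_expR// -expRD -[LHS]lnK ?posrE//; congr expR; lra.
  by rewrite [X in _ * X = _]vv; ring.
rewrite -h4; apply: lerXn2r; rewrite ?nnegrE//; first exact: layer_bound_ge0.
by apply: le_trans h3; exact: layer_bound_ge0.
Qed.

(** The cutoff gives [v^(-a - 1/2)] directly; the factor [(ln v)^(D a)] of the rate is at least
    [2^(-D a)] because [ln v >= 1/2]. *)
Lemma cutoff_rate (a b ka : R) (D : nat) : 0 < a -> a * ka = a + 2^-1 -> 1 <= ka ->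
  exists C : R, forall v J : nat, (2 <= v)%N ->
  v%:R `^ ka <= (2 ^ J)%:R :> R ->
  (ln v%:R : R) <= J%:R <= (2 * ka + 2) * ln v%:R ->
  layer_bound R a (D%:R * b) J ^+ 2 <= C * rate a b D v ^+ 2.
Proof.
move=> a0 aka ka1; pose c3 := 1 `^ (D%:R * b) + (2 * ka + 2) `^ (D%:R * b).
exists ((2 `^ (D%:R * a) * c3) ^+ 2) => v J v2 hJ hJ1.
have v0 : 0 < v%:R :> R by rewrite ltr0n (leq_trans _ v2).
have y2 := ln_nat_ge v v2.
have y0 : 0 < ln v%:R :> R by lra.
have J0 : (0 < J)%N.
  by rewrite -(ltr0n R); have /andP[h _] := hJ1; apply: lt_le_trans h.
have h1 : 2 `^ (- a * J%:R) <= v%:R `^ (- a - 2^-1).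
  have -> : v%:R `^ (- a - 2^-1) = expR (- (a * (ka * ln v%:R))).
    rewrite powR_expR//; congr expR.
    by rewrite mulrA aka; ring.
  rewrite powR_expR// ler_expR -mulrA mulNr lerN2 ler_wpM2l ?(ltW a0)//.
  rewrite -ler_expR -powR_expR//; apply: le_trans hJ _.
  by rewrite expRM_natl lnK ?posrE// natrX.
have h2 : (maxn J 1)%:R `^ (D%:R * b) <= c3 * ln v%:R `^ (D%:R * b).
  by apply: powR_comparable => //; rewrite (maxn_idPl J0) mul1r.
have h3 : 1 <= 2 `^ (D%:R * a) * ln v%:R `^ (D%:R * a).
  rewrite -powRM//; last exact: ltW.
  rewrite powR_expR ?mulr_gt0//.
  rewrite -[leLHS]expR0 ler_expR mulr_ge0 ?mulr_ge0 ?(ltW a0)// ln_ge0//; lra.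
have h4 : layer_bound R a (D%:R * b) J <=
    2 `^ (D%:R * a) * c3 * rate a b D v.
  apply: (@le_trans _ _ (v%:R `^ (- a - 2^-1) * (c3 * ln v%:R `^ (D%:R * b)))).
    by rewrite /layer_bound ler_pM ?powR_ge0.
  have -> : 2 `^ (D%:R * a) * c3 * rate a b D v =
    (2 `^ (D%:R * a) * ln v%:R `^ (D%:R * a)) *
      (v%:R `^ (- a - 2^-1) * (c3 * ln v%:R `^ (D%:R * b))).
    have yD : ln v%:R `^ (D%:R * (a + b)) =
        ln v%:R `^ (D%:R * a) * ln v%:R `^ (D%:R * b) :> R.
      by rewrite !powR_expR// -expRD; congr expR; ring.
    by rewrite /rate yD; ring.
  by rewrite ler_peMl// mulr_ge0 ?powR_ge0// mulr_ge0 ?powR_ge0// addr_ge0 ?powR_ge0.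
rewrite -exprMn; apply: lerXn2r; rewrite ?nnegrE//; first exact: layer_bound_ge0.
by apply: le_trans h4; exact: layer_bound_ge0.
Qed.

End Rates.

(** * Least squares error *)

Section LeastSquares.
Variable R : realType.
Local Notation C := R[i].
Local Notation e := (cexpi R).

Section Box.
Variables (d J : nat).
Local Notation I := (d.-tuple 'I_(2 ^ J.+2)).
Local Notation Q := (2 ^ J.+3)%N.
Local Notation X := ({ffun 'I_d -> 'I_Q}).
Local Notation freq := (Defs.shift d J.+1).
Local Notation pt := (gridpt R d Q).

(** Indexing by the whole box instead of the cross gives a plain type of tuples, with the logarithm
    of its cardinality still of order [J]. *)
Definition phi (i : I) (q : X) : C := e (dotk R d (freq i) (pt q)).

Definition boxpoly (c : I -> C) (x : d.-tuple R) : C :=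
  \sum_i c i * e (dotk R d (freq i) x).

Definition boxcoef (S : seq (d.-tuple int)) (c : d.-tuple int -> C) (i : I) : C :=
  if freq i \in S then c (freq i) else 0.

(** Squared moduli of box polynomials have frequencies up to [2 * 2^(J+1)]; below [Q] the grid
    integrates them exactly. *)
Let hQ : (2 * 2 ^ J.+1 < Q)%N.
Proof. by rewrite -expnS ltn_exp2l. Qed.

Let Q0 : (0 < Q)%N. Proof. by rewrite expn_gt0. Qed.

Lemma tpoly_box S c x : uniq S -> {subset S <= codom freq} ->
  tpoly R d S c x = boxpoly (boxcoef S c) x.
Proof.
move=> uS Sf; rewrite /tpoly /boxpoly.
rewrite (sum_reindex _ _ freq S (shift_inj d J.+1) uS Sf) big_mkcond/=.
by apply: eq_bigr => i _; rewrite /boxcoef; case: ifP => // _; rewrite mul0r.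
Qed.

Lemma boxpolyB c c' x : boxpoly (fun i => c i - c' i) x = boxpoly c x - boxpoly c' x.
Proof. by rewrite /boxpoly -sumrB; apply: eq_bigr => i _; rewrite mulrBl. Qed.

Lemma boxpoly_trig c : trig_below R d Q (fun x => sqn R (boxpoly c x)).
Proof. by apply: (trig_below_sqn R d Q (2 ^ J.+1)) => // t i; exact: shift_le. Qed.

Lemma phi_sqn i q : sqn R (phi i q) <= 1.
Proof. by rewrite sqn_cexpi. Qed.

Lemma phi_parseval (c : I -> C) :
  \sum_q sqn R (\sum_i c i * phi i q) = #|X|%:R * \sum_i sqn R (c i).
Proof.
apply: (grid_parseval R d Q (2 ^ J.+1)) => //; first exact: shift_inj.
by move=> t i; exact: shift_le.
Qed.

Lemma card_grid_gt0 : (0 < #|X|)%N.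
Proof. by rewrite card_ffun !card_ord expn_gt0 Q0. Qed.

Lemma sqn_add3 (z1 z2 z3 : C) :
  sqn R (z1 + z2 + z3) <= 4 * sqn R z1 + 4 * sqn R z2 + 2 * sqn R z3.
Proof.
have := sqnD_le R (z1 + z2) z3; have := sqnD_le R z1 z2; lra.
Qed.

Lemma L2norm_le (g : d.-tuple R -> C) (r : R) : 0 <= r ->
  (tint R d (fun x => (cabs R (g x) ^+ 2)%:E) <= r%:E)%E ->
  (L2norm R d g <= (Num.sqrt r)%:E)%E.
Proof.
move=> r0 gr; have g0 : (0 <= tint R d (fun x => (cabs R (g x) ^+ 2)%:E))%E.
  pose h x : \bar R := (cabs R (g x) ^+ 2)%:E.
  have hh x : torus R d x -> (0 <= h x <= h x)%E.
    by move=> _; rewrite lee_fin sqr_ge0/=.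
  by have /andP[] := le_tint R d h h hh.
rewrite /L2norm; case: tint g0 gr => [s| |]//= s0 sr.
by rewrite lee_fin ler_wsqrtr.
Qed.

Variables (m v : nat) (xi : m.-tuple X) (La : R).
Hypothesis m0 : (0 < m)%N.
Hypothesis La0 : 0 <= La.
Hypothesis xi_lower : forall c : I -> C, (#|[pred i | c i != 0%R]| <= v)%N ->
  \sum_i sqn R (c i) <= La * (m%:R^-1 * \sum_(q <- xi) sqn R (\sum_i c i * phi i q)).

Let pts : m.-tuple (d.-tuple R) := [tuple of map pt xi].

Let emp_errE f u : emp_err R d m pts f u = m%:R^-1 * \sum_(q <- xi) sqn R (f (pt q) - u (pt q)).
Proof.
rewrite /emp_err; congr (_ * _); rewrite [RHS]big_tuple; apply: eq_bigr => j _.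
by rewrite tnth_map cabs_sq.
Qed.

(** Split [f - w = (f - T) + (T - u) + (u - w)], with [T] the box polynomial, [u] the competitor and
    [w] any least squares solution. The pointwise bound on [f - T] serves both the integral and the
    sample; [T - u] is controlled by [E]; [u - w] lies in the span of [S], where the sampling
    inequality applies, and minimality of [w] bounds its sampled norm. *)
Lemma ls_error (f : d.-tuple R -> C) (cT : I -> C) (S : seq (d.-tuple int))
    (cu : d.-tuple int -> C) (eps E : R) :
  uniq S -> size S = v -> {subset S <= codom freq} ->
  (forall x, torus R d x -> sqn R (f x - boxpoly cT x) <= eps) ->
  (#|X|%:R^-1 * \sum_q sqn R (boxpoly cT (pt q) - tpoly R d S cu (pt q)) +
   m%:R^-1 * \sum_(q <- xi) sqn R (boxpoly cT (pt q) - tpoly R d S cu (pt q)) <= E) ->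
  forall c, is_LS R d m pts S f c ->
  (L2norm R d (fun x => (f x - tpoly R d S c x)%R) <=
   (Num.sqrt ((4 + 16 * La) * (eps + E)))%:E)%E.
Proof.
move=> uS Sv Sf fT hE c cLS.
have minv : 0 <= m%:R^-1 :> R by rewrite invr_ge0.
have Xinv : 0 <= #|X|%:R^-1 :> R by rewrite invr_ge0.
have tor q : torus R d (pt q) by exact: gridpt_torus.
have eps0 : 0 <= eps.
  have [q _] : exists q : X, true.
    by exists [ffun=> Ordinal Q0].
  exact: le_trans (sqn_ge0 _ _) (fT _ (tor q)).
set u := tpoly R d S cu in hE *; set w := tpoly R d S c.
set T := boxpoly cT in fT hE *.
set eX := #|X|%:R^-1 * _ in hE; set em := m%:R^-1 * _ in hE.
have eX0 : 0 <= eX by rewrite mulr_ge0// sumr_ge0// => q _; exact: sqn_ge0.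
have em0 : 0 <= em by rewrite mulr_ge0// sumr_ge0// => q _; exact: sqn_ge0.
have fu : m%:R^-1 * \sum_(q <- xi) sqn R (f (pt q) - u (pt q)) <= 2 * (eps + E).
  apply: (@le_trans _ _ (2 * eps + 2 * em)); last by lra.
  have -> : 2 * eps + 2 * em = m%:R^-1 * \sum_(q <- xi)
      (2 * eps + 2 * sqn R (T (pt q) - u (pt q))).
    rewrite big_split/= -!mulr_sumr big_const_seq count_predT size_tuple iter_addr_0.
    rewrite -[eps *+ m]mulr_natl mulrDr; congr (_ + _).
      by rewrite [RHS]mulrCA mulKf// pnatr_eq0 -lt0n.
    exact: mulrCA.
  rewrite ler_wpM2l//; apply: ler_sum => q _.
  have -> : f (pt q) - u (pt q) = (f (pt q) - T (pt q)) + (T (pt q) - u (pt q)).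
    by rewrite addrA subrK.
  by apply: le_trans (sqnD_le _ _ _) _; have := fT _ (tor q); lra.
have fw : m%:R^-1 * \sum_(q <- xi) sqn R (f (pt q) - w (pt q)) <= 2 * (eps + E).
  by have := cLS cu; rewrite !emp_errE => /le_trans; apply.
pose cd i := boxcoef S cu i - boxcoef S c i.
have uw x : u x - w x = boxpoly cd x.
  by rewrite /u /w !tpoly_box// -boxpolyB.
have uwm : m%:R^-1 * \sum_(q <- xi) sqn R (boxpoly cd (pt q)) <= 8 * (eps + E).
  apply: (@le_trans _ _ (2 * (m%:R^-1 * \sum_(q <- xi) sqn R (f (pt q) - w (pt q))) +
    2 * (m%:R^-1 * \sum_(q <- xi) sqn R (f (pt q) - u (pt q))))); last by lra.
  rewrite !mulr_sumr -big_split/=; apply: ler_sum => q _.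
  rewrite -uw mulrCA [2 * (_ * _)]mulrCA -mulrDr ler_wpM2l//.
  have -> : u (pt q) - w (pt q) = (f (pt q) - w (pt q)) - (f (pt q) - u (pt q)).
    by ring.
  exact: sqnB_le.
have cd_supp : (#|[pred i | cd i != 0%R]| <= v)%N.
  rewrite -Sv -(card_reindex _ _ freq S (shift_inj d J.+1) uS Sf).
  apply/subset_leq_card/fintype.subsetP => i; rewrite !inE.
  by apply: contraNT => iS; rewrite /cd /boxcoef (negbTE iS) subrr.
have uwX : #|X|%:R^-1 * \sum_q sqn R (boxpoly cd (pt q)) <= La * (8 * (eps + E)).
  have := phi_parseval cd; rewrite /boxpoly => ->.
  rewrite mulKf; last by rewrite pnatr_eq0 -lt0n card_grid_gt0.
  by apply: le_trans (xi_lower _ cd_supp) _; rewrite ler_wpM2l.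
have E0 : 0 <= E by apply: le_trans hE; rewrite addr_ge0.
apply: L2norm_le; first by apply: mulr_ge0; apply: addr_ge0 => //; rewrite mulr_ge0.
pose cTu i := cT i - boxcoef S cu i.
have Tu x : T x - u x = boxpoly cTu x by rewrite /u tpoly_box// -boxpolyB.
(* A trigonometric majorant of [|f - w|^2] on the torus, whose integral is a grid average. *)
pose g x := 4 * eps + (4 * sqn R (boxpoly cTu x) + 2 * sqn R (boxpoly cd x)).
have gtrig : trig_below R d Q g.
  apply: trig_below_add; first exact: trig_below_cst.
  by apply: trig_below_add; apply: trig_below_scale; exact: boxpoly_trig.
pose h x : \bar R := (cabs R (f x - w x) ^+ 2)%:E.
have fg x : torus R d x -> (0 <= h x <= (g x)%:E)%E.
  move=> xT; rewrite !lee_fin sqr_ge0/= cabs_sq /g -Tu -uw.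
  have -> : f x - w x = (f x - T x) + (T x - u x) + (u x - w x).
    by ring.
  by apply: le_trans (sqn_add3 _ _ _) _; have := fT _ xT; lra.
have /andP[_ /le_trans] := le_tint R d h _ fg; apply.
rewrite (trig_below_tint R d Q g Q0 gtrig) lee_fin /g.
rewrite !big_split/= -!mulr_sumr sumr_const -[eps *+ _]mulr_natl !mulrDr.
rewrite [X in X + _](_ : _ = 4 * eps); last first.
  by rewrite mulrCA mulKf// pnatr_eq0 -lt0n card_grid_gt0.
have -> : #|X|%:R^-1 * (4 * \sum_q sqn R (boxpoly cTu (pt q))) = 4 * eX.
  by rewrite mulrCA; congr (_ * (_ * _)); apply: eq_bigr => q _; rewrite -Tu.
rewrite [X in _ + (_ + X)]mulrCA.
nra.
Qed.

End Box.
End LeastSquares.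

Section Approximation.
Variable R : realType.
Local Notation C := R[i].
Local Notation e := (cexpi R).

Lemma Re_Im_le_cabs (z : C) : `|complex.Re z| + `|complex.Im z| <= 2 * cabs R z.
Proof. by have := Re_le_cabs R z; have := Im_le_cabs R z; lra. Qed.

(** The coefficients have norm [2 A] in terms of [|Re| + |Im|] and the two measures have mass [2],
    so Maurey's bound reads [(2 A / n)^2 * 8 n * 2]. The grid part serves the [L_2] error, the
    sampled part the least squares residual. *)
Lemma sparse_approx d Q m (xi : m.-tuple {ffun 'I_d -> 'I_Q})
    (mid : seq (d.-tuple int)) (F : d.-tuple int -> C) (A : R) (n : nat) :
  (0 < Q)%N -> (0 < m)%N -> (0 < n)%N -> 0 < A ->
  \sum_(k <- mid) cabs R (F k) <= A ->
  exists r : seq (C * d.-tuple int),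
  let err q := sqn R (\sum_(k <- mid) F k * e (dotk R d k (gridpt R d Q q)) -
                      \sum_(t <- r) t.1 * e (dotk R d t.2 (gridpt R d Q q))) in
  [/\ (size r <= n)%N, {subset [seq t.2 | t <- r] <= mid} &
   #|{ffun 'I_d -> 'I_Q}|%:R^-1 * \sum_q err q + m%:R^-1 * \sum_(q <- xi) err q <=
   64 * A ^+ 2 / n%:R].
Proof.
move=> Q0 m0 n0 A0 midA.
have X0 : (0 < #|{ffun 'I_d -> 'I_Q}|)%N by rewrite card_ffun !card_ord expn_gt0 Q0.
have nR0 : 0 < n%:R :> R by rewrite ltr0n.
have [mid0|midn0] := posnP (size mid).
  move/size0nil: mid0 => ->; exists [::] => /=; split=> //.
  rewrite !big1 => [|q _|q _]; rewrite ?big_nil ?subrr ?sqn0//.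
  by rewrite !mulr0 addr0 divr_ge0// mulr_ge0// sqr_ge0.
pose k0 : d.-tuple int := [tuple 0 | i < d].
pose fr (i : 'I_(size mid)) := nth k0 mid i.
pose ph i (q : {ffun 'I_d -> 'I_Q}) := e (dotk R d (fr i) (gridpt R d Q q)).
have ph1 i q : sqn R (ph i q) <= 1 by rewrite sqn_cexpi.
have I0 : (0 < #|'I_(size mid)|)%N by rewrite card_ord.
have midE (V : nmodType) (G : d.-tuple int -> V) :
    \sum_(k <- mid) G k = \sum_(i < size mid) G (fr i).
  by rewrite (big_nth k0) big_mkord.
have A20 : 0 < 2 * A by rewrite mulr_gt0.
have cA : \sum_i (`|complex.Re (F (fr i))| + `|complex.Im (F (fr i))|) <= 2 * A.
  apply: (@le_trans _ _ (2 * \sum_(k <- mid) cabs R (F k))); last by rewrite ler_pM2l.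
  by rewrite midE mulr_sumr; apply: ler_sum => i _; exact: Re_Im_le_cabs.
pose nu q : R := #|{ffun 'I_d -> 'I_Q}|%:R^-1 + (count_mem q xi)%:R / m%:R.
have nu0 q : 0 <= nu q by rewrite addr_ge0// ?divr_ge0// invr_ge0.
have nuE (G : {ffun 'I_d -> 'I_Q} -> R) : \sum_q nu q * G q =
    #|{ffun 'I_d -> 'I_Q}|%:R^-1 * \sum_q G q + m%:R^-1 * \sum_(q <- xi) G q.
  rewrite -(sum_count_mem R _ xi) !mulr_sumr -big_split/=; apply: eq_bigr => q _.
  by rewrite /nu; ring.
have sum_nu : \sum_q nu q = 2.
  rewrite (eq_bigr (fun q => nu q * 1)); last by move=> q _; rewrite mulr1.
  rewrite nuE sumr_const big_const_seq count_predT size_tuple iter_addr_0.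
  by rewrite !mulVf// pnatr_eq0 -lt0n.
have [s sP] := maurey_L2_complex R _ _ ph ph1 I0 (fun i => F (fr i)) (2 * A)
  A20 cA n nu nu0.
pose la : R := 2 * A / n%:R.
pose co (a : 'I_(size mid) * bool * bool) : C :=
  la%:C%C * (((-1) ^+ a.2)%:C%C * rot R a.1.2).
exists [seq (co a, fr a.1.1) | a <- s] => err; split.
- by rewrite size_map size_tuple.
- move=> k /mapP[t /mapP[a _ ->] ->] /=.
  by rewrite /fr mem_nth.
have errE q : err q = la ^+ 2 *
    sqn R (deviation R _ _ ph (fun i => F (fr i)) (2 * A) n s q).
  rewrite -sqn_real -sqnM /err; congr sqn; rewrite /deviation mulrBr; congr (_ - _).
    rewrite midE mulrA -rmorphM/= /la.
    rewrite (_ : 2 * A / n%:R * (n%:R / (2 * A)) = 1) ?mul1r//.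
    by field; rewrite !gt_eqF.
  rewrite big_map mulr_sumr; apply: eq_bigr => a _ /=.
  by rewrite /co /atom /ph !mulrA.
rewrite -nuE (eq_bigr _ (fun q _ => congr1 (fun z => nu q * z) (errE q))).
rewrite (eq_bigr _ (fun q _ => mulrCA (nu q) (la ^+ 2) _)) -mulr_sumr.
rewrite sum_nu in sP.
apply: le_trans (ler_wpM2l (sqr_ge0 _) sP) _.
rewrite le_eqVlt; apply/orP; left; apply/eqP; rewrite /la; field.
by rewrite gt_eqF.
Qed.

Section FourierLayers.
Variables (d : nat) (a B K : R) (f : d.-tuple R -> C).
Hypothesis f_layers : forall j, Anorm_fj R d f j <= layer_bound R a B j.
Hypothesis f_conv : forall x, torus R d x ->
  (fun J : nat => cabs R (f x - \sum_(j < J) fj R d f j x)) @ \oo --> (0 : R).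
Hypothesis K_tail : forall n J : nat,
  \sum_(n <= j < J) layer_bound R a B j <= K * layer_bound R a B n.

Lemma fjE j x : fj R d f j x =
  \sum_(k <- layer_seq d j) fhat R d f k * e (dotk R d k x).
Proof. by rewrite /fj layer_sumE. Qed.

Lemma Anorm_fjE j : Anorm_fj R d f j = \sum_(k <- layer_seq d j) cabs R (fhat R d f k).
Proof. by rewrite /Anorm_fj layer_sumE. Qed.

Lemma cabs_fj_le j x : cabs R (fj R d f j x) <= layer_bound R a B j.
Proof.
apply: le_trans (f_layers j); rewrite fjE Anorm_fjE.
apply: le_trans (cabs_sum_le _ _ _ _ _) _.
by apply: ler_sum => k _; rewrite cabsM cabs_cexpi mulr1.
Qed.

(** A long partial sum is within [eps] of [f x]; the layers in between are bounded uniformly in [x]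
    by their [A]-norms. *)
Lemma remainder_le J x : torus R d x ->
  cabs R (f x - \sum_(j < J) fj R d f j x) <= K * layer_bound R a B J.
Proof.
move=> xT; apply/ler_addgt0Pr => eps eps0.
have /cvgrPdist_lt /(_ eps eps0) [N _ hN] := f_conv x xT.
have := hN (maxn N J) (leq_maxl _ _); rewrite /= sub0r normrN ger0_norm ?cabs_ge0// => h.
have JM : (J <= maxn N J)%N by exact: leq_maxr.
have -> : f x - \sum_(j < J) fj R d f j x =
    (f x - \sum_(j < maxn N J) fj R d f j x) + \sum_(J <= j < maxn N J) fj R d f j x.
  rewrite -(big_mkord xpredT (fun j => fj R d f j x)).
  rewrite -(big_mkord xpredT (fun j => fj R d f j x)).
  have -> : \sum_(0 <= j < maxn N J) fj R d f j x =
      \sum_(0 <= j < J) fj R d f j x + \sum_(J <= j < maxn N J) fj R d f j x.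
    exact: big_cat_nat.
  by ring.
apply: le_trans (cabsD_le _ _ _) _; rewrite addrC lerD ?(ltW h)//.
apply: le_trans (cabs_sum_le _ _ _ _ _) _.
by apply: le_trans (K_tail J (maxn N J)); apply: ler_sum => j _; exact: cabs_fj_le.
Qed.

End FourierLayers.

Definition layers_seq d n J : seq (d.-tuple int) :=
  flatten [seq layer_seq d j | j <- index_iota n J].

Lemma layers_seq_sum (V : nmodType) d n J (G : d.-tuple int -> V) :
  \sum_(k <- layers_seq d n J) G k = \sum_(n <= j < J) \sum_(k <- layer_seq d j) G k.
Proof. by rewrite /layers_seq big_flatten big_map. Qed.

Lemma mem_layers_seq d n J k : k \in layers_seq d n J ->
  exists2 j, (n <= j < J)%N & k \in layer_seq d j.
Proof.
by move=> /flattenP[s /mapP[j]]; rewrite mem_index_iota => jJ -> kj; exists j.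
Qed.

Lemma size_layers_seq D n : (size (layers_seq D.+1 0 n) <= 2 ^ (D.+1 + n) * n ^ D)%N.
Proof.
rewrite size_flatten /shape -map_comp sumnE big_map big_mkord.
apply: (@leq_trans (\sum_(j < n) 2 ^ (D.+1 + j) * n ^ D)%N).
  apply: leq_sum => j _; apply: leq_trans (size_layer_seq D j) _.
  have mono E : (j.+1 ^ E <= n ^ E)%N by case: E => [|E]//; rewrite leq_exp2r.
  by rewrite leq_mul2l mono orbT.
rewrite -big_distrl/= leq_mul2r; apply/orP; right.
under eq_bigr do rewrite expnD.
rewrite -big_distrr/= expnD leq_mul2l; apply/orP; right.
have -> : (\sum_(j < n) 2 ^ j = (2 ^ n).-1)%N by rewrite predn_exp mul1n.
exact: leq_pred.
Qed.

End Approximation.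

Lemma codom_hyperbolic_cross d J :
  {subset hyperbolic_cross d J <= codom (Defs.shift d J.+1)}.
Proof. by move=> k /mapP[t _ ->]; exact: codom_f. Qed.

(** * Least squares error for one function of the class *)

Section FinalError.
Variables (R : realType) (D : nat) (a b K : R).
Local Notation C := R[i].
Local Notation e := (cexpi R).
Local Notation lb := (layer_bound R a (D%:R * b)).
Hypothesis K0 : 0 < K.
Hypothesis K_tail : forall n J : nat, \sum_(n <= j < J) lb j <= K * lb n.

Lemma sparse_ls_error (v n J m : nat) (La : R)
    (xi : m.-tuple {ffun 'I_D.+1 -> 'I_(2 ^ J.+3)}) (f : D.+1.-tuple R -> C) :
  (2 <= v)%N -> n = 0%N \/ (2 ^ (D.+2 + n) * n ^ D <= v)%N -> (n <= J)%N ->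
  (v <= 2 ^ J)%N -> (0 < m)%N -> 0 <= La ->
  (forall c : D.+1.-tuple 'I_(2 ^ J.+2) -> C, (#|[pred i | c i != 0%R]| <= v)%N ->
    \sum_i sqn R (c i) <=
    La * (m%:R^-1 * \sum_(q <- xi) sqn R (\sum_i c i * phi R D.+1 J i q))) ->
  (forall j, Anorm_fj R D.+1 f j <= lb j) ->
  (forall x, torus R D.+1 x ->
    (fun J : nat => cabs R (f x - \sum_(j < J) fj R D.+1 f j x)) @ \oo --> (0 : R)) ->
  exists2 S, vsubsets D.+1 v (hyperbolic_cross D.+1 J) S &
  forall c, is_LS R D.+1 m [tuple of map (gridpt R D.+1 (2 ^ J.+3)) xi] S f c ->
  (L2norm R D.+1 (fun x => (f x - tpoly R D.+1 S c x)%R) <=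
   (Num.sqrt ((4 + 16 * La) *
      ((K * lb J) ^+ 2 + 192 * ((K * lb n) ^+ 2 / v%:R))))%:E)%E.
Proof.
move=> v2 nv nJ vJ m0 La0 xiP fA fconv.
set G := hyperbolic_cross D.+1 J.
pose F := fhat R D.+1 f.
pose low := layers_seq D.+1 0 n; pose mid := layers_seq D.+1 n J.
pose n0 := v./2.
have n00 : (0 < n0)%N by rewrite half_gt0.
have lown : (size low <= n0)%N.
  case: nv => [n_0|nv]; first by rewrite /low n_0.
  apply: leq_trans (size_layers_seq D n) _.
  rewrite -[leqLHS]doubleK half_leq// -muln2 mulnC mulnA -expnS.
  by rewrite -addSn.
have lb0 j : 0 < lb j.
  by rewrite /layer_bound mulr_gt0 ?powR_gt0// ltr0n leq_max orbT.
have A0 : 0 < K * lb n by rewrite mulr_gt0.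
have midA : \sum_(k <- mid) cabs R (F k) <= K * lb n.
  rewrite layers_seq_sum; apply: le_trans (K_tail n J); apply: ler_sum => j _.
  by rewrite -Anorm_fjE.
have Q0 : (0 < 2 ^ J.+3)%N by rewrite expn_gt0.
have [r] := sparse_approx R D.+1 (2 ^ J.+3) m xi mid F (K * lb n) n0 Q0 m0 n00 A0 midA.
set err := (fun q => sqn R _) => -[rn rmid rerr].
have layG j k : (j < J)%N -> k \in layer_seq D.+1 j -> k \in G.
  move=> jJ /layer_seq_gprod kj; rewrite mem_hyperbolic_cross.
  by apply: leq_trans kj _; rewrite leq_exp2l// ltnW.
have lowG : {subset low <= G}.
  by move=> k /mem_layers_seq[j /andP[_ jn]]; apply: layG; exact: leq_trans nJ.
have midG : {subset mid <= G}.
  by move=> k /mem_layers_seq[j /andP[_ jJ]]; exact: layG.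
pose ru : seq (C * D.+1.-tuple int) := [seq (F k, k) | k <- low] ++ r.
pose rT : seq (C * D.+1.-tuple int) := [seq (F k, k) | k <- low ++ mid].
have rTG : {subset [seq t.2 | t <- rT] <= G}.
  move=> k; rewrite /rT -map_comp => /mapP[k' + ->] /=.
  by rewrite mem_cat => /orP[/lowG|/midG].
have ruG : {subset [seq t.2 | t <- ru] <= G}.
  move=> k; rewrite /ru map_cat mem_cat -map_comp => /orP[/mapP[k' + ->]|] /=.
    exact: lowG.
  by move=> /rmid /midG.
have uG : uniq G := hyperbolic_cross_uniq D.+1 J.
have ru_v : (size [seq t.2 | t <- ru] <= v)%N.
  rewrite size_map size_cat size_map.
  apply: leq_trans (leq_add lown rn) _; rewrite addnn -[leqRHS]odd_double_half.
  exact: leq_addl.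
have [S [uS Sv SG ruS]] := extend_freqs _ _ G v uG ruG ru_v
  (size_hyperbolic_cross_ge D J v vJ).
exists S; first by split.
(* [cT] holds the Fourier sum up to [J]; [cu] is the sparse competitor, made of the low layers and
   Maurey's terms. *)
pose cT := boxcoef R D.+1 J G (fun k => \sum_(t <- rT | t.2 == k) t.1).
pose cu k := \sum_(t <- ru | t.2 == k) t.1.
have TE x : boxpoly R D.+1 J cT x =
    \sum_(k <- low) F k * e (dotk R D.+1 k x) + \sum_(k <- mid) F k * e (dotk R D.+1 k x).
  rewrite /cT -tpoly_box//; last exact: codom_hyperbolic_cross.
  by rewrite -(tpoly_collect R D.+1 rT G x uG rTG) /rT big_map big_cat.
have uE x : tpoly R D.+1 S cu x =
    \sum_(k <- low) F k * e (dotk R D.+1 k x) + \sum_(t <- r) t.1 * e (dotk R D.+1 t.2 x).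
  by rewrite -(tpoly_collect R D.+1 ru S x uS ruS) /ru big_cat/= big_map.
have fE x : \sum_(j < J) fj R D.+1 f j x = boxpoly R D.+1 J cT x.
  rewrite TE !layers_seq_sum -(big_mkord xpredT (fun j => fj R D.+1 f j x)).
  have -> : \sum_(0 <= j < J) fj R D.+1 f j x =
      \sum_(0 <= j < n) fj R D.+1 f j x + \sum_(n <= j < J) fj R D.+1 f j x.
    exact: big_cat_nat.
  by congr (_ + _); apply: eq_bigr => j _; rewrite fjE.
have fT x : torus R D.+1 x -> sqn R (f x - boxpoly R D.+1 J cT x) <= (K * lb J) ^+ 2.
  move=> xT; rewrite -cabs_sq -fE; apply: lerXn2r; rewrite ?nnegrE ?cabs_ge0//.
    by rewrite mulr_ge0// ltW.
  exact: (remainder_le R D.+1 a (D%:R * b) K f fA fconv K_tail).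
have errE q : sqn R (boxpoly R D.+1 J cT (gridpt R D.+1 (2 ^ J.+3) q) -
    tpoly R D.+1 S cu (gridpt R D.+1 (2 ^ J.+3) q)) = err q.
  by rewrite TE uE /err; congr sqn; ring.
apply: (ls_error R D.+1 J m v xi La m0 La0 xiP f cT S cu _ _ uS Sv) => //.
  by move=> k /SG; exact: codom_hyperbolic_cross.
rewrite (eq_bigr _ (fun q _ => errE q)) [X in _ + _ * X](eq_bigr _ (fun q _ => errE q)).
apply: le_trans rerr _.
have v0 : 0 < v%:R :> R by rewrite ltr0n (leq_trans _ v2).
have n0R : 0 < n0%:R :> R by rewrite ltr0n.
rewrite ler_pdivrMr// mulrA mulrAC ler_pdivlMr//.
(* Halving rounds down, so only [v / 3] is guaranteed; hence [192 = 64 * 3]. *)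
have vn : v%:R <= 3 * n0%:R :> R.
  by rewrite -natrM ler_nat /n0; have := odd_double_half v; lia.
have := sqr_ge0 (K * lb n); nra.
Qed.

End FinalError.

Theorem theorem5p1 (R : realType) (d : nat) (a : R) :
  (0 < d)%N -> 0 < a ->
  exists c c' : R, forall b : R, exists C' : R,
  forall v : nat, (2 <= v)%N ->
  exists (M : R) (G : seq (d.-tuple int)),
    [/\ uniq G,
        (forall k, k \in G <-> inGamma R d M k),
        (size G)%:R <= v%:R `^ c &
        forall m : nat, c' * v%:R * ln (2 * v%:R) ^+ 4 <= m%:R ->
          (rho_ls R d m v (WA R d a b) G <=
            (C' * v%:R `^ (- a - 2^-1) * ln v%:R `^ ((d%:R - 1) * (a + b) + 2^-1))%:E)%E].
Proof.
case: d => // D _ a0.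
have [c [c1 [c0 c10 full]]] := full_layers R D.
(* Chosen so that [2^J >= v^ka] implies [2^(-a J) <= v^(-a - 1/2)]. *)
pose ka : R := 1 + (2 * a)^-1.
have ka1 : 1 <= ka by rewrite lerDl invr_ge0 mulr_ge0// ltW.
have aka : a * ka = a + 2^-1 by rewrite /ka; field; rewrite gt_eqF.
(* The cross has at most [2^((J + 2) d)] elements, and [(J + 2) ln 2 <= ka ln v + 3 ln 2 <= (ka + 3)
   ln v]. *)
pose cG : R := (ka + 3) * D.+1%:R.
have cG0 : 0 <= cG by rewrite mulr_ge0//; lra.
(* [cG + 2] plays the role of [B] in [sparse_sampling]: the [2] pays for the four rotations of each
   exponential. *)
exists cG, (sampling_rate R * (cG + 2 + 3)) => b.
have dD : D.+1%:R - 1 = D%:R :> R by rewrite -(natr1 D) addrK.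
have [K K0 K_tail] := layer_tail R a (D%:R * b) a0.
have [C1 low] := low_rate R a b c c1 D a0 c0 c10.
have [C2 cut] := cutoff_rate R a b ka D a0 aka ka1.
(* [4 <= 8 ln v] and [ln (2v) <= 2 ln v] turn [4 + 16 La] into [W ln v]. *)
pose W : R := 8 + 32 * sampling_loss R.
pose Ct : R := K ^+ 2 * C2 + 192 * (K ^+ 2 * C1).
exists (Num.sqrt (W * Ct)) => v v2.
have v0 : 0 < v%:R :> R by rewrite ltr0n (leq_trans _ v2).
have y2 : ln 2 <= ln v%:R :> R by rewrite ler_ln ?posrE// ler_nat.
have l2 := ln2_ge R.
have l1 := ln_double_ge1 R v v2.
have lE : ln (2 * v%:R) = ln 2 + ln v%:R :> R by rewrite lnM ?posrE.
have [n [nv hn hn1 h2n]] := full v v2.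
have [J [hJ vJ hJ1 hJ2]] := cutoff_layer R ka v ka1 v2.
have nJ : (n <= J)%N by rewrite -(@leq_exp2l 2)// (leq_trans h2n).
have logsize : (J.+2 * D.+1)%:R * ln 2 <= cG * ln v%:R :> R.
  rewrite natrM mulrAC /cG [leRHS]mulrAC ler_wpM2r//.
  rewrite -(natr1 J.+1) -(natr1 J); lra.
exists (2 ^ J)%:R, (hyperbolic_cross D.+1 J); split.
- exact: hyperbolic_cross_uniq.
- by move=> k; apply: iff_sym; exact: inGammaE.
- apply: (@le_trans _ _ (2 ^ (J.+2 * D.+1))%:R).
    by rewrite ler_nat size_hyperbolic_cross.
  rewrite powR_expR// natrX -[X in X ^+ _ <= _](lnK _) ?posrE//.
  by rewrite -expRM_natl ler_expR.
move=> m hm.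
have sr0 := sampling_rate_gt0 R.
have hm3 : sampling_rate R * (cG + 2 + 3) * v%:R * ln (2 * v%:R) ^+ 3 <= m%:R.
  apply: le_trans hm; rewrite ler_wpM2l//; last by rewrite ler_weXn2l.
  by rewrite mulr_ge0// mulr_ge0// ?(ltW sr0)//; lra.
have m0 : (0 < m)%N.
  rewrite -(ltr0n R); apply: lt_le_trans hm3.
  rewrite mulr_gt0 ?exprn_gt0//; last by lra.
  by rewrite mulr_gt0// mulr_gt0//; lra.
have cardI : #|{: D.+1.-tuple 'I_(2 ^ J.+2)}| = (2 ^ (J.+2 * D.+1))%N.
  by rewrite card_tuple card_ord expnM.
have I0 : (0 < #|{: D.+1.-tuple 'I_(2 ^ J.+2)}|)%N by rewrite cardI expn_gt0.
have lnI : ln (4 * #|{: D.+1.-tuple 'I_(2 ^ J.+2)}|)%:R <= (cG + 2) * ln (2 * v%:R) :> R.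
  rewrite cardI (_ : 4 = 2 ^ 2)%N// -expnD natrX lnXn// -[ln 2 *+ _]mulr_natl natrD mulrDl lE.
  by nra.
have cG2 : 0 <= cG + 2 by lra.
have [xi xiP] := sparse_sampling R _ _ (phi R D.+1 J) (phi_sqn R D.+1 J)
  (phi_parseval R D.+1 J) I0 (card_grid_gt0 D.+1 J) (cG + 2) v m v2 cG2 lnI hm3.
have sl0 := sampling_loss_ge0 R.
have La0 : 0 <= sampling_loss R * ln (2 * v%:R) by rewrite mulr_ge0//; lra.
rewrite /rho_ls; apply: le_trans.
  apply: ereal_inf_lbound; exists [tuple of map (gridpt R D.+1 (2 ^ J.+3)) xi] => //=.
  by move=> j; rewrite tnth_map; exact: gridpt_torus.
apply: ge_ereal_sup => _ [f [_ fA fconv] <-].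
have fA' j : Anorm_fj R D.+1 f j <= layer_bound R a (D%:R * b) j.
  by have := fA j; rewrite dD.
have [S SG Serr] := sparse_ls_error R D a b K K0 K_tail v n J m _ xi f v2 nv nJ vJ m0
  La0 xiP fA' fconv.
apply: le_trans; first by apply: ereal_inf_lbound; exists S.
apply: ge_ereal_sup => _ [cc ccLS <-]; apply: le_trans (Serr cc ccLS) _.
rewrite lee_fin dD.
have rate_n := low v n v2 hn hn1.
have rate_J := cut v J v2 hJ hJ1.
set H := rate R a b D v in rate_n rate_J.
have y0 : 0 < ln v%:R :> R by lra.
have -> : Num.sqrt (W * Ct) * v%:R `^ (- a - 2^-1) *
    ln v%:R `^ (D%:R * (a + b) + 2^-1) = Num.sqrt (ln v%:R * H ^+ 2 * (W * Ct)).
  have H0 : 0 <= H by rewrite mulr_ge0 ?powR_ge0.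
  have e1 : Num.sqrt (ln v%:R * H ^+ 2) = ln v%:R `^ 2^-1 * H.
    by rewrite sqrtrM ?(ltW y0)// sqrtr_sqr ger0_norm// powR12_sqrt// ltW.
  rewrite [RHS]sqrtrM; last by rewrite mulr_ge0 ?sqr_ge0// ltW.
  have yD : ln v%:R `^ (D%:R * (a + b) + 2^-1) =
      ln v%:R `^ (D%:R * (a + b)) * ln v%:R `^ 2^-1 :> R.
    by rewrite powRD// (gt_eqF y0) implybT.
  by rewrite e1 yD /H /rate; ring.
apply: ler_wsqrtr.
have H20 : 0 <= H ^+ 2 by exact: sqr_ge0.
have h1 : 4 + 16 * (sampling_loss R * ln (2 * v%:R)) <= ln v%:R * W.
  by rewrite lE /W; nra.
have h2 : (K * layer_bound R a (D%:R * b) J) ^+ 2 +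
    192 * ((K * layer_bound R a (D%:R * b) n) ^+ 2 / v%:R) <= H ^+ 2 * Ct.
  have K2 : 0 <= K ^+ 2 by exact: sqr_ge0.
  have -> : (K * layer_bound R a (D%:R * b) n) ^+ 2 / v%:R =
    K ^+ 2 * (layer_bound R a (D%:R * b) n ^+ 2 / v%:R) by rewrite exprMn mulrA.
  rewrite [(K * layer_bound R a (D%:R * b) J) ^+ 2]exprMn /Ct.
  have := ler_wpM2l K2 rate_n; have := ler_wpM2l K2 rate_J.
  move: (layer_bound _ _ _ J ^+ 2) (layer_bound _ _ _ n ^+ 2 / _) (H ^+ 2) (K ^+ 2).
  by move=> p q h k; lra.
have -> : ln v%:R * H ^+ 2 * (W * Ct) = ln v%:R * W * (H ^+ 2 * Ct) by ring.
apply: ler_pM => //; first by lra.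
rewrite addr_ge0 ?sqr_ge0// mulr_ge0// divr_ge0 ?sqr_ge0 ?(ltW v0)//.
Qed.
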